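(* Let $p$ be a prime, let $T$ be a finite abelian $p$-group, let $\psi\colon T\to\mathbb{Q}/\mathbb{Z}$ be tame and quadratic with $|T/T^\perp|=p^e$, and let $B$ be a symmetric bilinear form over $\mathbb{Z}$ (on a finitely generated free $\mathbb{Z}$-module) with $\det B$ prime to $p$. Then $$\beta(B\otimes\psi)=\sigma_p(B)\cdot\beta(\psi)+\frac{\ell_p(\det B)\cdot e}{2}\in\mathbb{Q}/\mathbb{Z}.$$
   Context: Quadratic functions: $\psi\colon T\to\mathbb{Q}/\mathbb{Z}$ on a finite abelian group is quadratic if $\psi(ax)=a^2\psi(x)$ for all $a\in\mathbb{Z}$, $x\in T$, and $b(x,y)=\psi(x+y)-\psi(x)-\psi(y)$ is bilinear. $T^\perp=\{t\in T: b(t,s)=0\ \forall s\in T\}$; $\psi$ is tame if $\psi|_{T^\perp}=0$. With $G(\psi)=\sum_{t\in T}e^{2\pi i\psi(t)}$, when $G(\psi)\ne0$ (equivalently, $\psi$ is tame) the phase $\beta(\psi)$ is defined by $G(\psi)=|G(\psi)|e^{2\pi i\beta(\psi)}$. For tame quadratic $\psi$ one has $8\beta(\psi)=0$ in $\mathbb{Q}/\mathbb{Z}$, so $\beta(\psi)$ may be multiplied by an integer mod $8$. Tensor: for $B\colon V\times V\to\mathbb{Z}$ symmetric bilinear with basis $e_1,\dots,e_n$ of $V$, $B\otimes\psi\colon V\otimes T\to\mathbb{Q}/\mathbb{Z}$ is the quadratic function $(B\otimes\psi)(\sum_i e_i\otimes t_i)=\sum_i B(e_i,e_i)\psi(t_i)+\sum_{i<j}B(e_i,e_j)b(t_i,t_j)$,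 so that $(B\otimes\psi)(v\otimes x)=B(v,v)\psi(x)$. Residue symbols: for $p$ odd and $a$ prime to $p$, $\ell_p(a)=0$ if $a$ is a quadratic residue mod $p$ and $1$ otherwise; for $a$ odd, $\ell_2(a)=0$ if $a\equiv\pm1\bmod8$ and $1$ if $a\equiv\pm3\bmod 8$. Reduced forms: a pseudo-hyperbolic is an integral matrix $\begin{pmatrix}2m_1&1\\1&2m_2\end{pmatrix}$. A symmetric integral matrix is reduced if it is an orthogonal (block diagonal) sum of rank one forms and pseudo-hyperbolics. Symmetric integral matrices $A$ and $C$ of the same size are $8$-similar if there is an integral matrix $M$ with $\det M$ odd and $C\equiv M^{tr}AM\bmod 8$. Definition of $\sigma_p$: for a symmetric integral matrix $A$ with $\det A$ prime to $p$, $\sigma_p(A)$ is the integer mod $8$ given by $\sigma_p(A)\equiv\mathrm{rank}\,A$ if $p$ is odd, and $\sigma_2(A)\equiv N_1-N_{-1}+3N_3-3N_{-3}$ if $p=2$, where $N_i$ is the number of rank one (diagonal) summands with entry congruent to $i$ mod $8$ in any reduced matrix $8$-similar to $A$ (such a matrix exists and the result mod $8$ does not depend on which is chosen). *)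

(* Defs.v *)
From HB Require Import structures.
From mathcomp Require Import all_boot all_order all_fingroup all_algebra all_solvable
  ring_quotient.
From mathcomp Require Import complex.
From mathcomp Require Import boolp classical_sets reals trigo.

Set Implicit Arguments.
Unset Strict Implicit.
Unset Printing Implicit Defensive.

Import Order.TTheory GRing.Theory Num.Theory.

Local Open Scope quotient_scope.
Local Open Scope ring_scope.

(* The subgroup Z of Q. *)
Definition intQ : zmodClosed rat :=
  GRing.ZmodClosed.clone rat Num.int_num_subdef _.

Notation QmodZ := {ideal_quot intQ}.

Definition toQmodZ (q : rat) : QmodZ := \pi q.

(* x |-> e^(2 pi i x), computed on a representative of x, the choice of
   which is immaterial by [expQZ_toQmodZ]. *)
Definition expQZ (R : realType) (x : QmodZ) : R[i] :=
  let r : R := ratr (generic_quotient.repr x) in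
  Complex (cos (2 * pi * r)) (sin (2 * pi * r)).

Lemma expQZ_toQmodZ (R : realType) (q : rat) :
  expQZ R (toQmodZ q) =
  Complex (cos (2 * pi * ratr q)) (sin (2 * pi * ratr q)).
Proof.
rewrite /expQZ /toQmodZ; set r := generic_quotient.repr _.
have /intrP[z Ez] : r - q \is a Num.int.
  have := Quotient.idealrBE intQ r q; rewrite /r generic_quotient.reprK eqxx.
  by move=> h; exact: h.
have -> : ratr r = ratr q + z%:~R :> R.
  by rewrite -[r](subrK q) Ez rmorphD /= ratr_int addrC.
have per (f : R -> R) (a : R) : periodic f (pi *+ 2) ->
    f (2 * pi * (a + z%:~R)) = f (2 * pi * a).
  move=> fP; rewrite mulrDr mulr_natl; case: z {Ez} => n.
    by rewrite mulr_natr periodicn.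
  rewrite NegzE mulrNz mulrN mulr_natr.
  by rewrite -(periodicn fP n.+1) subrK.
by rewrite !per //; [exact: sinD2pi | exact: cosD2pi].
Qed.

(* Bilinearity over Z, for abelian groups seen as Z-modules. *)
Definition biadditive (U V W : zmodType) (f : U -> V -> W) : Prop :=
  (forall v, zmod_morphism (f^~ v)) /\ (forall u, zmod_morphism (f u)).

Section QuadraticFunctions.

Variable T : finZmodType.
Implicit Type psi : T -> QmodZ.

Definition polar psi (x y : T) : QmodZ := psi (x + y) - psi x - psi y.

Definition quadratic psi : Prop :=
  (forall (a : int) (x : T), psi (x *~ a) = psi x *~ (a ^+ 2))
  /\ biadditive (polar psi).

(* T^\perp *)
Definition radical psi : {set T} :=
  [set t : T | [forall s : T, polar psi t s == 0]].

Definition tame psi : Prop := forall t, t \in radical psi -> psi t = 0.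

End QuadraticFunctions.

Definition gauss (R : realType) (X : finType) (psi : X -> QmodZ) : R[i] :=
  \sum_(t : X) expQZ R (psi t).

(* For tame quadratic psi the Gauss sum is nonzero and exactly one x satisfies
   the condition. *)
Definition phase (R : realType) (X : finType) (psi : X -> QmodZ) : QmodZ :=
  xget 0 [set x : QmodZ | gauss R psi = `|gauss R psi| * expQZ R x]%classic.

Definition is_Zbasis (V : zmodType) n (e : 'I_n -> V) : Prop :=
  bijective (fun c : {ffun 'I_n -> int} => \sum_i e i *~ c i).

Definition gram (V : zmodType) n (e : 'I_n -> V) (B : V -> V -> int) : 'M[int]_n :=
  \matrix_(i, j) B (e i) (e j).

(* With e a basis of V, V (x) T is identified with T^n, the family t standing
   for \sum_i e_i (x) t_i. *)
Definition tensor (V : zmodType) n (e : 'I_n -> V) (B : V -> V -> int)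
    (T : finZmodType) (psi : T -> QmodZ) (t : {ffun 'I_n -> T}) : QmodZ :=
  \sum_(i < n) psi (t i) *~ B (e i) (e i)
  + \sum_(i < n) \sum_(j < n | (i < j)%N) polar psi (t i) (t j) *~ B (e i) (e j).

(* The residue symbol ell_p(a), for a prime to p. *)
Definition ell (p : nat) (a : int) : nat :=
  if p == 2%N then ((a %% 8)%Z \notin [:: 1; 7])
  else ~~ [exists x : 'I_p, ((x%:Z ^+ 2) == a %[mod p])%Z].

Inductive summand := RankOne of int | PseudoHyp of int & int.

Definition summand_dim (b : summand) : nat := if b is RankOne _ then 1 else 2.

Definition summand_mx (b : summand) : 'M[int]_(summand_dim b) :=
  match b with
  | RankOne a => a%:M
  | PseudoHyp m1 m2 => block_mx (2 * m1)%:M 1%:M 1%:M (2 * m2)%:M : 'M_(1 + 1)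
  end.

Fixpoint reduced_dim (s : seq summand) : nat :=
  if s is b :: s' then (summand_dim b + reduced_dim s')%N else 0%N.

(* The reduced matrix with successive diagonal blocks s. *)
Fixpoint reduced_mx (s : seq summand) : 'M[int]_(reduced_dim s) :=
  match s with
  | [::] => 0
  | b :: s' => block_mx (summand_mx b) 0 0 (reduced_mx s')
  end.

Definition similar8 n (A C : 'M[int]_n) : Prop :=
  exists M : 'M[int]_n,
    ~~ (2 %| \det M)%Z /\
    forall i j, (C i j = (M^T *m A *m M) i j %[mod 8])%Z.

(* N_i *)
Definition count_rank1 (i : int) (s : seq summand) : nat :=
  count (fun b => if b is RankOne a then (a == i %[mod 8])%Z else false) s.

Definition sigma2_reduced (s : seq summand) : 'Z_8 :=
  (count_rank1 1 s)%:R - (count_rank1 (-1) s)%:R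
  + 3%:R * (count_rank1 3 s)%:R - 3%:R * (count_rank1 (-3) s)%:R.

(* sigma_p(A), for det A prime to p.  The rank of A is then its size n, and for
   p = 2 the set below is a singleton: A is 8-similar to some reduced matrix,
   and all choices of one give the same value.  An element of 'Z_8 acts on
   phases through its representative in {0, ..., 7}, since phases of tame
   quadratic functions are killed by 8. *)
Definition sigma (p n : nat) (A : 'M[int]_n) : 'Z_8 :=
  if p == 2%N then
    xget 0 [set v : 'Z_8 | exists (s : seq summand) (eq_n : reduced_dim s = n),
      similar8 A (castmx (eq_n, eq_n) (reduced_mx s)) /\ v = sigma2_reduced s]%classic
  else n%:R.

(* Main.v *)
Require Import Defs.
From HB Require Import structures.
From mathcomp Require Import all_boot all_order all_fingroup all_algebra all_solvable
  ring_quotient.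
From mathcomp Require Import complex.
From mathcomp Require Import boolp classical_sets reals trigo.
From mathcomp Require Import ssrAC ring lra.

Set Implicit Arguments.
Unset Strict Implicit.
Unset Printing Implicit Defensive.

Import Order.TTheory GRing.Theory Num.Theory.
Local Open Scope ring_scope.

(* Write G(psi) for the Gauss sum and b for the polarization. Replacing A by
   M^T A M with det M prime to p, or changing the entries of A modulo a number
   that kills psi, does not change G(A (x) psi), and G is multiplicative on
   block sums, so A may be diagonalised when p is odd and reduced when p = 2.

   For odd p, each a prime to p satisfies G(a psi) = (-1)^(ell_p(a) e) G(psi):
   passing from a subgroup to the orthogonal of one of its elements x, with
   b(x, -) killed by p, either leaves G unchanged and divides the order of the
   subgroup by p (if b(x, x) = 0), or divides G by a quadratic Gauss sum over
   F_p.  For p = 2, the same descent shows that the hexagonal form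
   H = ((2, 1), (1, 2)) has G(H (x) psi) = (-1)^e |G(psi)|^2.  The
   equivalence of <1, 1, 1> with <3> + H then gives
   G(psi)^3 = G(3 psi) (-1)^e |G(psi)|^2, from which follow both
   8 beta(psi) = 0 and beta(a psi) = a beta(psi) + ell_2(a) e / 2 for odd a.
   A pseudo-hyperbolic plus <1> is equivalent to a diagonal form.  Finally
   sigma_2 is well defined because the form x^2 / 4 on Z/2, whose phase has
   order 8, only sees the matrix modulo 8. *)

(** For odd [p] the relation [b(x, x) = 2 psi(x)] makes an element isotropic for [b] isotropic for
    [psi], which is what the descent needs. At [p = 2] this fails: [psi(x)] may be [1/2] while
    [b(x, x) = 0], and the restriction of a tame [psi] to the orthogonal of [x] need not be tame.
    The hexagonal form avoids the obstacle because its diagonal is even: its values are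
    [b(u, u) + b(u, v) + b(v, v)], which depend on [b] alone.

    The radical changes along a descent, so the exponent of the sign is not computed on the way. It
    is left existential in a statement whose absolute values determine it, and is identified with
    [e] only on the whole group, through [|G(psi)|^2 = |T| |T^perp|].

    At [p = 2] a reduction modulo 8 is not enough to compute a Gauss sum, since the values of [psi]
    may have any 2-power order. The matrix is therefore reduced modulo a large [2 ^ N]; the result
    is in particular one of the reduced matrices allowed in the definition of [sigma_2]. *)

Arguments expQZ : simpl never.

(** * The exponential character of Q/Z *)

Section ExpQZ.

Variable R : realType.
Implicit Types x y : QmodZ.

Lemma toQmodZ_is_zmod_morphism : zmod_morphism toQmodZ.
Proof. by move=> x y; rewrite /toQmodZ raddfB. Qed.

HB.instance Definition _ :=
  GRing.isZmodMorphism.Build rat QmodZ toQmodZ toQmodZ_is_zmod_morphism.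

Lemma toQmodZ_surj x : exists q, x = toQmodZ q.
Proof. by exists (generic_quotient.repr x); rewrite /toQmodZ generic_quotient.reprK. Qed.

Lemma toQmodZ_eq0 q : (toQmodZ q == 0) = (q \is a Num.int).
Proof.
rewrite -(raddf0 toQmodZ) /toQmodZ -[in RHS](subr0 q).
by rewrite -(Quotient.idealrBE intQ).
Qed.

Lemma expQZ0 : expQZ R 0 = 1.
Proof. by rewrite -(raddf0 toQmodZ) expQZ_toQmodZ raddf0 mulr0 cos0 sin0. Qed.

Lemma expQZD x y : expQZ R (x + y) = expQZ R x * expQZ R y.
Proof.
have [[a ->] [b ->]] := (toQmodZ_surj x, toQmodZ_surj y).
rewrite -raddfD !expQZ_toQmodZ rmorphD /= mulrDr cosD sinD.
by apply/eqP; rewrite eq_complex /= eqxx /= addrC.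
Qed.

Lemma expQZN x : expQZ R (- x) = (expQZ R x)^*%C.
Proof.
have [a ->] := toQmodZ_surj x.
by rewrite -raddfN !expQZ_toQmodZ rmorphN /= mulrN cosN sinN.
Qed.

Lemma norm_expQZ x : `|expQZ R x| = 1.
Proof.
have [a ->] := toQmodZ_surj x.
by rewrite expQZ_toQmodZ normc_def /= cos2Dsin2 sqrtr1.
Qed.

Lemma expQZ_neq0 x : expQZ R x != 0.
Proof. by rewrite -normr_eq0 norm_expQZ oner_eq0. Qed.

Lemma expQZMn x n : expQZ R (x *+ n) = expQZ R x ^+ n.
Proof. by elim: n => [|n IH]; rewrite ?expQZ0 // mulrS exprS expQZD IH. Qed.

(** On the representative [q] in [[0, 1)], [cos (2 pi q) = 1] forces [sin (pi q) = 0], whereas the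
    sine is positive strictly between 0 and [pi]. *)
Lemma expQZ_eq1 x : (expQZ R x == 1) = (x == 0).
Proof.
apply/eqP/eqP => [|->]; last exact: expQZ0.
have [q0 Eq0] := toQmodZ_surj x.
pose q := q0 - (Num.floor q0)%:~R.
have -> : x = toQmodZ q.
  rewrite Eq0; apply/eqP; rewrite -subr_eq0 -raddfB toQmodZ_eq0 /q opprB addrC subrK.
  exact: intr_int.
rewrite expQZ_toQmodZ => -[cos1 _].
have q_ge0 : 0 <= q by rewrite subr_ge0 floor_le_tmp.
have q_lt1 : q < 1 by rewrite ltrBlDr addrC -[X in _ + X]/(1%:~R) -intrD floorD1_gt.
case: (eqVneq q 0) => [->|q_neq0]; first by rewrite raddf0.
have q_gt0 : 0 < q by rewrite lt_def q_neq0.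
have : 0 < sin (pi * ratr q : R).
  apply: sin_gt0_pi; rewrite mulr_gt0 ?pi_gt0 ?ltr0q //=.
  by rewrite gtr_pMr ?pi_gt0 // -[1](rmorph1 ratr) ltr_rat.
move: cos1; rewrite -mulrA mulr_natl cos_mulr2n cos2sin2 => h s_gt0.
have : sin (pi * ratr q : R) ^+ 2 = 0 by lra.
by move/eqP; rewrite sqrf_eq0 gt_eqF.
Qed.

Lemma expQZ_inj : injective (expQZ R).
Proof.
move=> x y Exy; apply/eqP; rewrite -subr_eq0 -expQZ_eq1 expQZD Exy -expQZD subrr.
by rewrite expQZ0.
Qed.

Lemma expQZ_half : expQZ R (toQmodZ (1 / 2)) = -1.
Proof.
set x := toQmodZ _; have : expQZ R x ^+ 2 == 1 ^+ 2.
  by rewrite -expQZMn expr1n expQZ_eq1 -raddfMn toQmodZ_eq0.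
rewrite eqf_sqr expQZ_eq1 toQmodZ_eq0 => /orP[//|/eqP ->//].
Qed.

Lemma expQZ_halfn n : expQZ R (toQmodZ (n%:R / 2)) = (-1) ^+ n.
Proof.
rewrite -expQZ_half -expQZMn -raddfMn; congr (expQZ R (toQmodZ _)).
by rewrite mul1r mulr_natl.
Qed.

Lemma conjCE (z : R[i]) : z^* = z^*%C.
Proof.
by have [->|z0] := eqVneq z 0; [rewrite !rmorph0 | apply: (mulfI z0);
  rewrite -normCK sqr_normc].
Qed.

End ExpQZ.

Lemma toQmodZ_muln_eq0 (n m : nat) : (0 < n)%N ->
  (toQmodZ (m%:R / n%:R) == 0) = (n %| m)%N.
Proof.
move=> n_gt0; rewrite toQmodZ_eq0.
have n0 : n%:R != 0 :> rat by rewrite pnatr_eq0 -lt0n.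
apply/idP/dvdnP => [/intrP[z Ez]|[q ->]]; last by rewrite natrM mulfK // rpred_nat.
exists `|z|%N; move: Ez => /(canRL (divfK n0)) Ez; apply/eqP.
have : m%:R = (`|z|%N)%:R * n%:R :> rat.
  suff -> : (`|z|%N)%:R = z%:~R :> rat by [].
  have : 0 <= z%:~R :> rat.
    by rewrite -(pmulr_lge0 _ (_ : 0 < n%:R)) ?ltr0n // -Ez ler0n.
  by rewrite ler0z => /gez0_abs {2}<-.
by rewrite -natrM => /eqP; rewrite eqr_nat.
Qed.

(** Transported by [expQZ], this is the fact that every [p]-th root of unity is a power of a given
    nontrivial one. *)
Lemma QmodZ_prime_torsion (R : realType) p (c d : QmodZ) : prime p ->
  c *+ p = 0 -> c != 0 -> d *+ p = 0 -> exists j : 'I_p, d = c *+ j.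
Proof.
move=> pr_p pc c0 pd.
have zp1 (x : QmodZ) : x *+ p = 0 -> expQZ R x ^+ p = 1.
  by move=> px; rewrite -expQZMn px expQZ0.
have [m prim_m m_p] := prim_order_exists (prime_gt0 pr_p) (zp1 c pc).
have m_eq : m = p.
  move/primeP: pr_p => [_ /(_ m m_p)] /orP[/eqP m1|/eqP //].
  by have := prim_expr_order prim_m; rewrite m1 expr1 => /eqP; rewrite expQZ_eq1 (negPf c0).
rewrite m_eq in prim_m; have [j Ej] := prim_rootP prim_m (zp1 d pd).
by exists j; apply: (@expQZ_inj R); rewrite expQZMn.
Qed.

(** * Additive maps, and descent along subgroups of a finite abelian group *)

Section ZmodMorphism.

Variables (U V : zmodType) (f : U -> V).
Hypothesis fB : zmod_morphism f.

Let g : {additive U -> V} := HB.pack f (GRing.isZmodMorphism.Build U V f fB).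

Lemma zmod_morphism0 : f 0 = 0. Proof. exact: raddf0 g. Qed.
Lemma zmod_morphismD : {morph f : x y / x + y}. Proof. exact: raddfD g. Qed.
Lemma zmod_morphismMn n : {morph f : x / x *+ n}. Proof. exact: raddfMn g n. Qed.
Lemma zmod_morphismMz n : {morph f : x / x *~ n}. Proof. exact: raddfMz g n. Qed.
Lemma zmod_morphism_sum (I : Type) (r : seq I) (P : pred I) (F : I -> U) :
  f (\sum_(i <- r | P i) F i) = \sum_(i <- r | P i) f (F i).
Proof. exact: raddf_sum g _ _ _ _. Qed.

End ZmodMorphism.

Section Subgroups.

Variable T : finZmodType.
Implicit Type A : {set T}.

Lemma zmod_closedMn A x n : zmod_closed A -> x \in A -> x *+ n \in A.
Proof.
move=> [A0 AB] Ax; elim: n => [|n IH]; rewrite ?mulr0n // mulrS -[_ *+ n]opprK.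
by apply: (AB) => //; rewrite -sub0r; apply: AB.
Qed.

Lemma zmod_closed_add A x y : zmod_closed A -> x \in A -> y \in A -> x + y \in A.
Proof.
by move=> [A0 AB] Ax Ay; rewrite -[y]opprK AB // -sub0r AB.
Qed.

Lemma mulrn_card (x : T) : x *+ #|T| = 0.
Proof.
have := @expg_cardG T [set: T]%G x (finset.in_setT _).
by rewrite cardsT FinRing.zmodXgE FinRing.zmod1gE.
Qed.

Lemma mulrz_card_dvd (x : T) (m : int) : (#|T| %| m)%Z -> x *~ m = 0.
Proof. by case/dvdzP => q ->; rewrite mulrC mulrzA -pmulrn mulrn_card mul0rz. Qed.

(* [A] is the union of the [p] cosets [y *+ j + ker f]. *)
Lemma sum_prime_cosets (R : realType) (M : nmodType) p (f : T -> QmodZ) A y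
    (F : T -> M) :
  prime p -> {morph f : x1 x2 / x1 + x2} -> zmod_closed A ->
  (forall t, t \in A -> f t *+ p = 0) -> y \in A -> f y != 0 ->
  \sum_(t in A) F t =
  \sum_(j < p) \sum_(t in [set t in A | f t == 0]) F (y *+ j + t).
Proof.
move=> pr_p fD zA pf Ay fy.
have f0 : f 0 = 0 by apply: (addrI (f 0)); rewrite -fD !addr0.
have fMn x n : f (x *+ n) = f x *+ n by elim: n => // n IH; rewrite !mulrS fD IH.
have inj_j (i j : 'I_p) : f y *+ i = f y *+ j -> i = j.
  wlog le_ij : i j / (i <= j)%N => [H|Eij].
    by case/orP: (leq_total i j) => ? ?; [|apply: esym]; apply: H.
  have : f y *+ (j - i) = 0 by rewrite mulrnBr // Eij subrr.
  have : coprime p (j - i) || (i == j :> nat).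
    case: eqP => [|/eqP ne]; first by rewrite orbT.
    rewrite orbF prime_coprime // gtnNdvd ?subn_gt0 ?(ltn_neqAle i) ?ne ?le_ij //.
    exact: leq_ltn_trans (leq_subr _ _) (ltn_ord j).
  case/orP => [cop fz|/eqP /ord_inj //].
  case/negP: fy; have [u v E _] := egcdnP (j - i) (prime_gt0 pr_p).
  have -> : f y = f y *+ (u * p - v * (j - i)) by rewrite E addKn (eqP cop).
  have le : (v * (j - i) <= u * p)%N by rewrite E leq_addr.
  by rewrite mulrnBr // mulnC mulrnA pf // [(v * _)%N]mulnC mulrnA fz !mul0rn subrr.
transitivity (\sum_(t in A) \sum_(j < p | f t == f y *+ j) F t).
  apply: eq_bigr => t At.
  have [j Ej] := QmodZ_prime_torsion R pr_p (pf y Ay) fy (pf t At).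
  rewrite (big_pred1 j) // => i /=; rewrite Ej.
  by apply/eqP/eqP => [/inj_j -> | ->].
rewrite (exchange_big_dep xpredT) //=; apply: eq_bigr => j _.
have AyM := zmod_closedMn j zA Ay.
rewrite (reindex_onto (fun t => y *+ j + t) (fun t => t - y *+ j)) /=; last first.
  by move=> t _; rewrite addrC subrK.
apply: eq_bigl => t; rewrite addrC addrK eqxx andbT inE fD fMn -subr_eq0 addrK.
congr (_ && _); apply/idP/idP => h; last exact: zmod_closed_add.
by rewrite -(addrK (y *+ j) t); apply: zA.2.
Qed.

Lemma zmod_closed_ker (f : T -> QmodZ) A : {morph f : x y / x + y} ->
  zmod_closed A -> zmod_closed [set t in A | f t == 0].
Proof.
move=> fD [A0 AB]; have f0 : f 0 = 0 by apply: (addrI (f 0)); rewrite -fD !addr0.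
split=> [|x y]; first by rewrite inE A0 f0 /=.
rewrite !inE => /andP[Ax /eqP fx] /andP[Ay /eqP fy]; rewrite AB //=.
by apply/eqP/(addIr (f y)); rewrite -fD subrK fx fy addr0.
Qed.

(* Shrinks a subgroup to the orthogonal of one of its elements [x], chosen so
   that [b x] has values in the [p]-torsion. *)
Lemma bilinear_subgroup_ind (p : nat) (b : T -> T -> QmodZ) (P : {set T} -> Prop) :
  (p.-group [set: T])%g -> prime p -> biadditive b ->
  (forall A, zmod_closed A -> {in A &, forall x y, b x y = 0} -> P A) ->
  (forall A x y, zmod_closed A -> x \in A -> y \in A ->
     {in A, forall t, b x t *+ p = 0} -> b x y != 0 -> (b x x != 0 -> y = x) ->
     P [set t in A | b x t == 0] -> P A) ->
  P [set: T].
Proof.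
move=> pT pr_p [bl br] P0 Pstep.
have [N cardT] : exists N, #|T| = (p ^ N)%N.
  by have /p_natP[N cardT] := pT; exists N; rewrite -cardT cardsT.
suff PA m : forall A, zmod_closed A -> (#|A| < m)%N -> P A.
  by apply: (PA #|T|.+1); [split=> [|? ? _ _]; exact: finset.in_setT | rewrite cardsT].
elim: m => // m IH A zA; rewrite ltnS => Am.
have [A0|] := pselect {in A &, forall x y, b x y = 0}; first exact: P0.
move=> nb; have [x0 [y0 [Ax0 Ay0 bxy]]] : exists x y, [/\ x \in A, y \in A & b x y != 0].
  apply: contrapT => H; apply: nb => x y Ax Ay; apply: contrapT => /eqP bxy.
  by apply: H; exists x, y.
pose Q n := [forall (y | y \in A), b (x0 *+ p ^ n) y == 0].
have exQ : exists n, Q n.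
  exists N; apply/forall_inP => y _; rewrite -cardT mulrn_card.
  by rewrite (zmod_morphism0 (bl y)).
(* [n.+1] is the least exponent for which [x0 *+ p ^ n.+1] is orthogonal to [A]. Hence [b x] is
   killed by [p] for [x = x0 *+ p ^ n], and by minimality [x] is not orthogonal to [A], which
   provides [y] when [b x x = 0]. *)
case: (ex_minnP exQ) => -[|n] /forall_inP Qn minn.
  by have := Qn _ Ay0; rewrite expn0 mulr1n (negPf bxy).
pose x := x0 *+ p ^ n.
have Ax : x \in A by apply: zmod_closedMn.
have px t : t \in A -> b x t *+ p = 0.
  by move=> At; rewrite -(zmod_morphismMn (bl t)) -mulrnA -expnSr; apply/eqP/Qn.
have [y [Ay bxy' yx]] : exists y, [/\ y \in A, b x y != 0 & b x x != 0 -> y = x].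
  have [bxx|] := eqVneq (b x x) 0; last by exists x.
  apply: contrapT => H; suff : (n < n)%N by rewrite ltnn.
  apply: minn; apply/forall_inP => t At; apply: contrapT => /negP bt.
  by apply: H; exists t.
apply: (Pstep A x y) => //; apply: IH.
  by apply: zmod_closed_ker => //; apply: zmod_morphismD.
apply: leq_trans Am; apply: proper_card; apply/properP; split.
  by apply/fintype.subsetP => t; rewrite inE => /andP[].
by exists y => //; rewrite inE Ay.
Qed.

End Subgroups.

(** * Quadratic functions and their polarizations *)

Section Quadratic.

Variables (T : finZmodType) (psi : T -> QmodZ).
Hypothesis qpsi : quadratic psi.

Lemma quadraticMz x (a : int) : psi (x *~ a) = psi x *~ (a ^+ 2).
Proof. exact: qpsi.1. Qed.

Lemma quadraticMn x n : psi (x *+ n) = psi x *+ n ^ 2.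
Proof. by have := quadraticMz x n; rewrite -!pmulrn. Qed.

Lemma quadratic0 : psi 0 = 0.
Proof. by have := quadraticMn 0 0; rewrite !mulr0n. Qed.

Lemma quadraticD x y : psi (x + y) = psi x + psi y + polar psi x y.
Proof. by rewrite /polar -(addrA (psi (x + y))) -opprD [RHS]addrC subrK. Qed.

Lemma polarC x y : polar psi x y = polar psi y x.
Proof. by rewrite /polar [y + x]addrC addrAC. Qed.

Lemma polar_xx x : polar psi x x = psi x *+ 2.
Proof.
by rewrite /polar -mulr2n quadraticMn -(addrA (_ *+ _)) -opprD -mulr2n -mulrnBr.
Qed.

Let bl := qpsi.2.1.
Let br := qpsi.2.2.

Lemma polar0l y : polar psi 0 y = 0. Proof. exact: zmod_morphism0 (bl y). Qed.
Lemma polarDl x1 x2 y : polar psi (x1 + x2) y = polar psi x1 y + polar psi x2 y.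
Proof. exact: (zmod_morphismD (bl y) x1 x2). Qed.
Lemma polarDr x y1 y2 : polar psi x (y1 + y2) = polar psi x y1 + polar psi x y2.
Proof. exact: (zmod_morphismD (br x) y1 y2). Qed.
Lemma polarMnl x y n : polar psi (x *+ n) y = polar psi x y *+ n.
Proof. exact: (zmod_morphismMn (bl y) n x). Qed.
Lemma polarMzl x y n : polar psi (x *~ n) y = polar psi x y *~ n.
Proof. exact: (zmod_morphismMz (bl y) n x). Qed.
Lemma polarMzr x y n : polar psi x (y *~ n) = polar psi x y *~ n.
Proof. exact: (zmod_morphismMz (br x) n y). Qed.

Lemma polar_scale a x y : polar (fun t => psi t *~ a) x y = polar psi x y *~ a.
Proof. by rewrite /polar !mulrzBl. Qed.

Lemma quadratic_scale a : quadratic (fun t => psi t *~ a).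
Proof.
split=> [m x|]; first by rewrite quadraticMz -!mulrzA mulrC.
split=> [v x y|u x y]; rewrite !polar_scale -mulrzBl; congr (_ *~ _).
  exact: bl.
exact: br.
Qed.

End Quadratic.

(** * Character sums and the absolute value of a Gauss sum *)

Section CharacterSums.

Variables (R : realType) (T : finZmodType).
Implicit Types (A : {set T}) (chi : T -> R[i]).

(** Translation by [x0] multiplies the sum by [chi x0], which is not 1. *)
Lemma sum_nontrivial_char A chi x0 : zmod_closed A ->
  {morph chi : x y / x + y >-> x * y} -> x0 \in A -> chi x0 != 1 ->
  \sum_(t in A) chi t = 0.
Proof.
move=> zA chiD Ax0 chi_x0; set S := LHS.
suff /eqP : chi x0 * S = S.
  rewrite -subr_eq0 -{2}[S]mul1r -mulrBl mulf_eq0 subr_eq0 (negPf chi_x0).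
  by move/eqP.
rewrite mulr_sumr /S [RHS](reindex_inj (addrI x0)) /=.
apply: eq_big => [t|t _]; last by rewrite chiD.
apply/idP/idP => h; first exact: zmod_closed_add.
by rewrite -(addKr x0 t) addrC; apply: zA.2.
Qed.

Lemma sum_QmodZ_char (f : T -> QmodZ) : {morph f : x y / x + y} ->
  \sum_t expQZ R (f t) = if [forall t, f t == 0] then #|T|%:R else 0.
Proof.
move=> fD; case: ifPn => [/forallP f0|/forallPn[x0 fx0]].
  rewrite (eq_bigr (fun=> 1)) ?sumr_const // => t _.
  by rewrite (eqP (f0 t)) expQZ0.
rewrite -[RHS](@sum_nontrivial_char [set: T]%SET (fun t => expQZ R (f t)) x0).
- by apply: eq_bigl => t; rewrite finset.in_setT.
- by split=> [|? ? _ _]; exact: finset.in_setT.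
- by move=> x y /=; rewrite fD expQZD.
- exact: finset.in_setT.
- by rewrite expQZ_eq1.
Qed.

(** Expanding the square and translating [t] by [s] leaves, for each [t], the sum over [s] of the
    character [polar psi t s]. It vanishes unless [t] is in the radical, and there tameness makes
    the factor [expQZ R (psi t)] equal to 1. *)
Lemma gauss_norm2 (psi : T -> QmodZ) : quadratic psi -> tame psi ->
  `|gauss R psi| ^+ 2 = #|T|%:R * #|radical psi|%:R.
Proof.
move=> qpsi tpsi; rewrite sqr_normc.
have -> : gauss R psi * (gauss R psi)^*%C =
    \sum_s \sum_t expQZ R (psi t) * expQZ R (polar psi t s).
  rewrite {2}/gauss rmorph_sum mulr_sumr; apply: eq_bigr => s _.
  transitivity (gauss R psi * expQZ R (- psi s)); first by rewrite expQZN.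
  rewrite mulr_suml (reindex_inj (addrI s)); apply: eq_bigr => t _.
  rewrite -!expQZD; congr (expQZ R _).
  by rewrite quadraticD // polarC // [_ - psi s]addrC -!addrA addKr.
rewrite exchange_big /=.
under eq_bigr => t _.
  rewrite -mulr_sumr sum_QmodZ_char; last exact: polarDr.
  over.
rewrite (bigID (fun t => t \in radical psi)) /= [X in _ + X]big1 ?addr0.
  rewrite (eq_bigr (fun=> #|T|%:R)) ?sumr_const ?mulr_natr // => t radt.
  by rewrite tpsi // expQZ0 mul1r; move: radt; rewrite inE => ->.
by move=> t; rewrite inE => /negPf ->; rewrite mulr0.
Qed.

Lemma gauss_neq0 (psi : T -> QmodZ) : quadratic psi -> tame psi -> gauss R psi != 0.
Proof.
move=> qpsi tpsi; rewrite -normr_eq0 -sqrf_eq0 gauss_norm2 // mulf_neq0 //.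
  by rewrite pnatr_eq0 -lt0n; apply/card_gt0P; exists 0.
rewrite pnatr_eq0 -lt0n; apply/card_gt0P; exists 0; rewrite inE.
by apply/forallP => s; rewrite polar0l.
Qed.

End CharacterSums.

(** * Squares and quadratic Gauss sums over a finite field of odd characteristic *)

Section FiniteFieldSquares.

Variable F : finFieldType.
Hypothesis F2 : 2 != 0 :> F.
Implicit Types a b c u v j : F.

Definition is_square a := [exists j : F, j ^+ 2 == a].

Definition sqrt_count c u := #|[pred j : F | c * j ^+ 2 == u]|.

Lemma sqrt_count_le2 c u : c != 0 -> (sqrt_count c u <= 2)%N.
Proof.
rewrite /sqrt_count => c0; case: (pickP [pred j : F | c * j ^+ 2 == u]) => [j0 /= /eqP <-|e0].
  apply: leq_trans (card_size [:: j0; - j0]).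
  apply: subset_leq_card; apply/fintype.subsetP => j; rewrite !inE.
  by rewrite (inj_eq (mulfI c0)) eqf_sqr.
by rewrite eq_card0.
Qed.

(* No two classes share a value, and the total count is [2 * #|F|]. *)
Lemma sqrt_count_nonsquare a u : ~~ is_square a ->
  (sqrt_count 1%R u + sqrt_count a u = 2)%N.
Proof.
move=> sqa; have a0 : a != 0.
  by apply: contraNneq sqa => ->; apply/existsP; exists 0; rewrite expr0n.
pose N := sqrt_count.
have N0 c : c != 0 -> N c 0 = 1%N.
  move=> c0; rewrite -[RHS](card1 (0 : F)); apply: eq_card => j.
  by rewrite !inE mulf_eq0 (negPf c0) sqrf_eq0.
have le2 v : (N 1%R v + N a v <= 2)%N.
  have [->|v0] := eqVneq v 0; first by rewrite !N0 ?oner_neq0.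
  have [/existsP[i /eqP Ei]|sqv] := boolP (is_square v); last first.
    rewrite [N 1%R v]eq_card0 ?sqrt_count_le2 // => j; rewrite !inE mul1r.
    by apply: contraNF sqv => Ej; apply/existsP; exists j.
  rewrite [N a v]eq_card0 ?addn0 ?sqrt_count_le2 ?oner_neq0 // => j; rewrite !inE.
  apply: contraNF sqa => /eqP Ej; apply/existsP; exists (i / j).
  have j0 : j != 0 by apply: contraNneq v0 => j0; rewrite -Ej j0 expr0n mulr0.
  by rewrite exprMn exprVn Ei -Ej mulfK // expf_neq0.
have tot c : (\sum_v N c v = #|F|)%N.
  rewrite -[RHS]sum1_card [RHS](partition_big (fun j => c * j ^+ 2) xpredT) //=.
  by apply: eq_bigr => v _; rewrite /N /sqrt_count -sum1_card.
apply/eqP; rewrite eqn_leq le2 /= leqNgt; apply/negP => ltu.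
have : (\sum_v (N 1%R v + N a v) < \sum_(v : F) 2)%N.
  rewrite [X in (X < _)%N](bigD1 u) // [X in (_ < X)%N](bigD1 u) //=.
  by rewrite -addSn leq_add // leq_sum.
by rewrite big_split /= !tot sum_nat_const muln2 addnn ltnn.
Qed.

(** The substantial case is that of two nonsquares: [b] is not some [j ^+ 2], so by
    [sqrt_count_nonsquare] it is some [a * j ^+ 2], and [a * b] is the square of [a * j]. *)
Lemma is_squareM a b : a != 0 -> b != 0 ->
  is_square (a * b) = (is_square a == is_square b).
Proof.
have sqM c d : c != 0 -> is_square c -> is_square (c * d) = is_square d.
  move=> c0 /existsP[i /eqP Ei]; have i0 : i != 0.
    by apply: contraNneq c0 => i0; rewrite -Ei i0 expr0n.
  apply/existsP/existsP => [][j /eqP Ej].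
    by exists (j / i); rewrite exprMn exprVn Ei Ej mulrC mulKf.
  by exists (i * j); rewrite exprMn Ei Ej.
move=> a0 b0; have [/sqM ->|sqa] := boolP (is_square a) => //.
have [/sqM sqb|sqb] := boolP (is_square b); first by rewrite mulrC sqb // (negPf sqa).
have := sqrt_count_nonsquare b sqa; rewrite [X in (X + _)%N]eq_card0 => [Nb|j]; last first.
  by rewrite !inE mul1r; apply: contraNF sqb => Ej; apply/existsP; exists j.
have /card_gt0P[j] : (0 < sqrt_count a b)%N by rewrite -[sqrt_count a b]add0n Nb.
rewrite inE => /eqP <-; rewrite mulrA -expr2 -exprMn.
by apply/existsP; exists (a * j).
Qed.

Lemma is_square_sqr a : is_square (a ^+ 2).
Proof. by apply/existsP; exists a. Qed.

Variables (R : realType) (chi : F -> R[i]).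
Hypotheses (chiD : {morph chi : x y / x + y >-> x * y}).

Lemma sum_char_nonsquare a : ~~ is_square a ->
  \sum_j chi (j ^+ 2) + \sum_j chi (a * j ^+ 2) = (\sum_j chi j) *+ 2.
Proof.
move=> sqa.
have E c : \sum_j chi (c * j ^+ 2) = \sum_u chi u *+ sqrt_count c u.
  rewrite (partition_big (fun j => c * j ^+ 2) xpredT) //=; apply: eq_bigr => u _.
  by rewrite -sumr_const; apply: eq_big => // j /eqP ->.
have -> : \sum_j chi (j ^+ 2) = \sum_j chi (1 * j ^+ 2) by apply: eq_bigr => j; rewrite mul1r.
rewrite !E -big_split -sumrMnl /=; apply: eq_bigr => u _.
by rewrite -mulrnDr sqrt_count_nonsquare.
Qed.

Hypotheses (chi0 : chi 0 = 1) (chi_neq1 : exists x, chi x != 1).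
Hypothesis (chiN : forall x, chi (- x) = (chi x)^*).

Lemma sum_char_field : \sum_j chi j = 0.
Proof.
have [x0 x0P] := chi_neq1; rewrite -[RHS](@sum_nontrivial_char R F [set: F]%SET chi x0) //.
- by apply: eq_bigl => t; rewrite finset.in_setT.
- by split=> [|? ? _ _]; exact: finset.in_setT.
Qed.

(** If [a] is not a square, the twisted and untwisted sums together meet every field element exactly
    twice, so they add up to twice the sum of [chi], which is 0. *)
Lemma field_gauss_twist a : a != 0 ->
  \sum_j chi (a * j ^+ 2) = (-1) ^+ (~~ is_square a) * \sum_j chi (j ^+ 2).
Proof.
move=> a0; have [/existsP[i /eqP Ei]|sqa] := boolP (is_square a); last first.
  have := sum_char_nonsquare sqa; rewrite sum_char_field mul0rn addrC => /eqP.
  by rewrite addr_eq0 mulN1r => /eqP.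
rewrite mul1r [RHS](reindex_inj (mulfI (_ : i != 0))) /=.
  by apply: eq_bigr => j _; rewrite exprMn Ei.
by apply: contraNneq a0 => i0; rewrite -Ei i0 expr0n.
Qed.

(** With [k = j + d] one has [k ^+ 2 - j ^+ 2 = d ^+ 2 + 2 * d * j], and the sum over [j] vanishes
    unless [d = 0], because 2 is invertible. *)
Lemma field_gauss_norm : `|\sum_j chi (j ^+ 2)| ^+ 2 = #|F|%:R.
Proof.
have [x0 x0P] := chi_neq1.
rewrite normCK rmorph_sum mulr_sumr.
have -> : \sum_j (\sum_k chi (k ^+ 2)) * (chi (j ^+ 2))^* =
    \sum_d chi (d ^+ 2) * \sum_j chi (2 * d * j).
  under [RHS]eq_bigr do rewrite mulr_sumr.
  rewrite [RHS]exchange_big; apply: eq_bigr => j _.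
  rewrite mulr_suml (reindex_inj (addrI j)); apply: eq_bigr => d _.
  have E (x y : F) : (x + y) ^+ 2 - x ^+ 2 = y ^+ 2 + 2 * y * x by ring.
  by rewrite -chiN -!chiD E.
rewrite (bigD1 0) //= [X in _ + X]big1 ?addr0 => [|d d0]; last first.
  rewrite [X in _ * X](_ : _ = 0) ?mulr0 // -[RHS]sum_char_field.
  by rewrite [RHS](reindex_inj (mulfI (mulf_neq0 F2 d0))).
rewrite expr0n chi0 mul1r (eq_bigr (fun=> 1)) ?sumr_const // => j _.
by rewrite mulr0 mul0r chi0.
Qed.

End FiniteFieldSquares.

(** * The residue symbol and quadratic Gauss sums modulo an odd prime *)

Section PrimeResidues.

Variable p : nat.
Hypotheses (pr_p : prime p) (p2 : p != 2%N).

Lemma Fp_two_neq0 : 2 != 0 :> 'F_p.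
Proof. by rewrite -(dvdn_pcharf (pchar_Fp pr_p)) dvdn_prime2. Qed.

Lemma Fp_intr_eq0 (a : int) : (a%:~R == 0 :> 'F_p) = (p %| a)%Z.
Proof.
by rewrite {1}[a]intEsign rmorphM /= rmorph_sign mulf_eq0 signr_eq0 /=
  -(dvdn_pcharf (pchar_Fp pr_p)) dvdzE.
Qed.

Lemma Fp_intr_neq0 (a : int) : coprimez a p -> a%:~R != 0 :> 'F_p.
Proof.
by rewrite coprimez_sym Fp_intr_eq0 dvdzE /coprimez /= -prime_coprime.
Qed.

Lemma ell_is_square a : ell p a = ~~ is_square (a%:~R : 'F_p).
Proof.
rewrite /ell (negPf p2); congr (nat_of_bool (~~ _)).
have E (x : int) : ((x ^+ 2 == a %[mod p])%Z) = (x%:~R ^+ 2 == a%:~R :> 'F_p).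
  by rewrite eqz_mod_dvd -Fp_intr_eq0 rmorphB rmorphXn subr_eq0.
apply/existsP/existsP => [][x]; first by rewrite E => h; exists x%:~R.
have ltx : (x < p)%N by rewrite -[X in (_ < X)%N](Fp_cast pr_p) ltn_ord.
by move=> h; exists (Ordinal ltx); rewrite E /= -pmulrn natr_Zp.
Qed.

Lemma ell_oddM a b : coprimez a p -> coprimez b p ->
  ell p (a * b) = (ell p a + ell p b)%N %[mod 2].
Proof.
move=> ap bp; rewrite !ell_is_square rmorphM /= is_squareM ?Fp_intr_neq0 ?Fp_two_neq0 //.
by do 2!case: (is_square _).
Qed.

Lemma ell_odd_sqr a : coprimez a p -> ell p (a ^+ 2) = 0%N.
Proof. by move=> ap; rewrite ell_is_square rmorphXn is_square_sqr. Qed.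

Variables (R : realType) (c : QmodZ).
Hypotheses (c0 : c != 0) (pc : c *+ p = 0).

Let chi (u : 'F_p) := expQZ R (c *+ u).

Let chi_nat (n : nat) : chi n%:R = expQZ R (c *+ n).
Proof.
rewrite /chi val_Fp_nat // [in RHS](divn_eq n p) mulrnDr mulnC mulrnA pc mul0rn.
by rewrite add0r.
Qed.

Let chiD : {morph chi : x y / x + y >-> x * y}.
Proof.
move=> x y; rewrite -[x]natr_Zp -[y]natr_Zp -natrD !chi_nat mulrnDr.
exact: expQZD.
Qed.

Let chi0 : chi 0 = 1.
Proof. by rewrite -[0]/(0%:R) chi_nat mulr0n expQZ0. Qed.

Let chiN x : chi (- x) = (chi x)^*.
Proof.
apply: (mulfI (expQZ_neq0 R (c *+ x))); rewrite -[X in X * _]/(chi x) -chiD.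
by rewrite subrr chi0 -normCK norm_expQZ expr1n.
Qed.

Let chi_int (m : int) : chi m%:~R = expQZ R (c *~ m).
Proof.
case: m => n; first by rewrite -!pmulrn chi_nat.
by rewrite NegzE !mulrNz chiN expQZN -!pmulrn chi_nat conjCE.
Qed.

Let chi_neq1 : exists x, chi x != 1.
Proof.
by exists 1; rewrite -[1]/(1%:R) chi_nat mulr1n expQZ_eq1.
Qed.

Let sum_Fp (M : nmodType) (f : nat -> M) : \sum_(j < p) f j = \sum_(u : 'F_p) f u.
Proof. by rewrite -!(big_mkord xpredT f) (Fp_cast pr_p). Qed.

Lemma prime_gauss_twist (a : int) : coprimez a p ->
  \sum_(j < p) expQZ R (c *+ j ^ 2 *~ a) =
  (-1) ^+ ell p a * \sum_(j < p) expQZ R (c *+ j ^ 2).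
Proof.
move=> ap; rewrite (sum_Fp (fun j => expQZ R (c *+ j ^ 2 *~ a))).
rewrite (sum_Fp (fun j => expQZ R (c *+ j ^ 2))) ell_is_square.
have E : \sum_u chi (u ^+ 2) = \sum_(u : 'F_p) expQZ R (c *+ u ^ 2).
  by apply: eq_bigr => u _; rewrite -chi_nat natrX natr_Zp.
rewrite -E -(field_gauss_twist chiD chi_neq1 (Fp_intr_neq0 ap)).
apply: eq_bigr => u _.
have -> : a%:~R * u ^+ 2 = (a * (u ^ 2)%N)%:~R :> 'F_p.
  by rewrite rmorphM /= -pmulrn natrX natr_Zp.
by rewrite chi_int mulrC mulrzA -pmulrn.
Qed.

Lemma prime_gauss_norm : `|\sum_(j < p) expQZ R (c *+ j ^ 2)| ^+ 2 = p%:R.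
Proof.
rewrite (sum_Fp (fun j => expQZ R (c *+ j ^ 2))).
have := field_gauss_norm Fp_two_neq0 chiD chi0 chi_neq1 chiN.
rewrite card_Fp // => <-.
congr (`|_| ^+ 2); apply: eq_bigr => u _.
by rewrite -chi_nat natrX natr_Zp.
Qed.

End PrimeResidues.

(** * Twists of a Gauss sum by integers, for odd [p] *)

Lemma mulrz_coprime_eq0 (c : QmodZ) p (a : int) : c *+ p = 0 -> coprimez a p ->
  (c *~ a == 0) = (c == 0).
Proof.
move=> pc /coprimezP[[u v] /= E]; apply/eqP/eqP => [ca|->]; last by rewrite mul0rz.
rewrite -[c]mulr1z -E mulrzDr [u * a]mulrC (mulrzA _ a u) ca mul0rz add0r.
by rewrite [v * _]mulrC (mulrzA _ p v) -pmulrn pc mul0rz.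
Qed.

Section OddTwist.

Variables (R : realType) (p : nat) (T : finZmodType) (psi : T -> QmodZ).
Hypotheses (pr_p : prime p) (p2 : p != 2%N) (pT : (p.-group [set: T])%g).
Hypothesis qpsi : quadratic psi.

Let odd_p : odd p. Proof. by case: (even_prime pr_p) p2 => [->|]. Qed.

(** The odd number [#|T| ^ 2] kills [psi x], so the factor 2 can be cancelled. *)
Lemma odd_group_psi_eq0 x n : psi x *+ (2 * p ^ n) = 0 -> psi x *+ p ^ n = 0.
Proof.
move=> h2; have /p_natP[N] := pT; rewrite cardsT => cardT.
have hT : psi x *+ (#|T| ^ 2) = 0 by rewrite -quadraticMn // mulrn_card quadratic0.
have cop : coprime 2 (#|T| ^ 2) by rewrite cardT coprime2n !oddX odd_p !orbT.
have [u v E _] := egcdnP (#|T| ^ 2) (isT : (0 < 2)%N).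
have : psi x *+ (p ^ n * (u * 2)) = 0.
  by rewrite mulnA [(_ * u)%N]mulnC -mulnA mulnC [(_ * 2)%N]mulnC mulrnA h2 mul0rn.
by rewrite E (eqP cop) mulnDr muln1 mulrnDr mulnA mulnC mulrnA hT mul0rn add0r.
Qed.

Lemma polar_self_eq0 x : polar psi x x = 0 -> psi x = 0.
Proof.
rewrite polar_xx // => h; have := @odd_group_psi_eq0 x 0.
by rewrite expn0 muln1 mulr1n; apply.
Qed.

Lemma odd_tame : tame psi.
Proof. by move=> t; rewrite inE => /forallP h; apply/polar_self_eq0/eqP/h. Qed.

Let G A (a : int) := \sum_(t in (A : {set T})) expQZ R (psi t *~ a).

(** The first clause determines [k] from the order of [A] and the absolute value of its sum, so the
    [k] found for the whole group can be recognised afterwards. *)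
Let twist_stmt (A : {set T}) := exists k : nat,
  #|A|%:R ^+ 2 = p%:R ^+ k * `|G A 1| ^+ 2 /\
  (forall a, coprimez a p -> G A a = (-1) ^+ (ell p a * k) * G A 1).

(* Averaging over the translations by multiples of [x]. *)
Lemma sum_isotropic (f : T -> QmodZ) (A : {set T}) x (F : T -> R[i]) :
  zmod_closed A -> x \in A -> {in A, forall t, f t *+ p = 0} ->
  (forall t, f (t + x) = f t) ->
  {in A, forall t, F (t + x) = F t * expQZ R (f t)} ->
  \sum_(t in A) F t = \sum_(t in [set t in A | f t == 0]) F t.
Proof.
move=> zA Ax pf fx Fx.
have p0 : p%:R != 0 :> R[i] by rewrite pnatr_eq0 -lt0n prime_gt0.
have Fxj j t : t \in A -> F (t + x *+ j) = F t * expQZ R (f t) ^+ j.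
  move=> At; elim: j => [|j IH]; first by rewrite mulr0n addr0 mulr1.
  have Atj : t + x *+ j \in A by rewrite zmod_closed_add ?zmod_closedMn.
  have fj i : f (t + x *+ i) = f t.
    by elim: i => [|i IHi]; rewrite ?addr0 // mulrSr addrA fx.
  by rewrite mulrSr addrA Fx // IH fj exprSr mulrA.
have shift j : \sum_(t in A) F (t + x *+ j) = \sum_(t in A) F t.
  have Axj : x *+ j \in A by rewrite zmod_closedMn.
  rewrite [RHS](reindex_inj (addIr (x *+ j))); apply: eq_bigl => t.
  apply/idP/idP => h; first exact: zmod_closed_add.
  by rewrite -(addrK (x *+ j) t); apply: zA.2.
apply: (mulfI p0); transitivity (\sum_(j < p) \sum_(t in A) F (t + x *+ j)).
  rewrite [RHS](eq_bigr (fun=> \sum_(t in A) F t)) => [|j _]; last exact: shift.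
  by rewrite sumr_const card_ord mulr_natl.
rewrite exchange_big mulr_sumr (bigID (fun t => f t == 0)) /= [X in _ + X]big1 ?addr0.
  apply: eq_big => [t|t /andP[At /eqP ft]]; first by rewrite inE.
  rewrite (eq_bigr (fun=> F t)) ?sumr_const ?card_ord ?mulr_natl // => j _.
  by rewrite Fxj // ft expQZ0 expr1n mulr1.
move=> t /andP[At ft].
rewrite (eq_bigr (fun j : 'I_p => F t * expQZ R (f t) ^+ j)) => [|j _]; last exact: Fxj.
rewrite -mulr_sumr.
apply/eqP; rewrite mulf_eq0; apply/orP; right.
have : (expQZ R (f t) - 1) * \sum_(j < p) expQZ R (f t) ^+ j == 0.
  by rewrite -subrX1 -expQZMn pf // expQZ0 subrr.
by rewrite mulf_eq0 subr_eq0 expQZ_eq1 (negPf ft).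
Qed.

Lemma card_prime_index (f : T -> QmodZ) (A : {set T}) y :
  {morph f : x1 x2 / x1 + x2} -> zmod_closed A ->
  {in A, forall t, f t *+ p = 0} -> y \in A -> f y != 0 ->
  #|A| = (p * #|[set t in A | f t == 0%R]|)%N.
Proof.
move=> fD zA pf Ay fy; rewrite -sum1_card.
rewrite (sum_prime_cosets R (fun=> 1%N) pr_p fD zA pf Ay fy) /=.
by rewrite sum_nat_const card_ord sum1_card.
Qed.

Lemma odd_twist_exists : twist_stmt [set: T]%SET.
Proof.
apply: (bilinear_subgroup_ind pT pr_p qpsi.2).
  move=> A zA bA; exists 0%N.
  have GA a : G A a = #|A|%:R.
    rewrite /G (eq_bigr (fun=> 1)) ?sumr_const // => t At.
    by rewrite polar_self_eq0 ?mul0rz ?expQZ0 // bA.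
  by split=> [|a _]; rewrite !GA ?muln0 mul1r // normr_nat.
move=> A x y zA Ax Ay pbx bxy yx [k [EH GH]].
have fD := polarDr qpsi x.
have cardA := card_prime_index fD zA pbx Ay bxy.
set H := [set t in A | _] in EH GH cardA.
have cardA2 : #|A|%:R ^+ 2 = p%:R ^+ 2 * #|H|%:R ^+ 2 :> R[i].
  by rewrite cardA natrM exprMn.
(* If [x] is isotropic, averaging over translations by its multiples restricts the sum to [H]. Since
   [#|A| = p * #|H|], the exponent grows by 2 and the sign does not change. *)
have [bxx|bxx] := eqVneq (polar psi x x) 0.
  have psix := polar_self_eq0 bxx.
  have GA a : coprimez a p -> G A a = G H a.
    move=> ap; rewrite /G (@sum_isotropic (fun t => polar psi x t *~ a) A x) //.
    - apply: eq_bigl => t; rewrite !inE; have [At|//] := boolP (t \in A).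
      by rewrite (mulrz_coprime_eq0 (pbx t At)).
    - by move=> t At; rewrite pmulrn -mulrzA mulrC mulrzA -pmulrn pbx // mul0rz.
    - by move=> t; rewrite polarDr // bxx addr0.
    - by move=> t At; rewrite quadraticD // psix addr0 mulrzDl expQZD polarC.
  have G1 : G A 1 = G H 1 by apply: GA; rewrite coprimezE /= coprime1n.
  exists k.+2; split; first by rewrite cardA2 EH G1 mulrA -exprD.
  move=> a ap; rewrite GA // GH // G1 -addn2 mulnDr muln2 exprD.
  by rewrite -[_ ^+ _.*2]signr_odd odd_double mulr1.
(* Otherwise the multiples of [x] represent the cosets of [H] and are orthogonal to it. The sum over
   [A] is that over [H] times a quadratic Gauss sum modulo [p], whose squared absolute value is [p],
   so the exponent grows by 1. *)
rewrite (yx bxx) in Ay bxy cardA => {yx y}.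
have psix : psi x != 0.
  by apply: contraNneq bxx => h; rewrite polar_xx // h mul0rn.
have ppsix : psi x *+ p = 0.
  by rewrite -(expn1 p); apply: odd_group_psi_eq0; rewrite expn1 mulrnA -polar_xx // pbx.
pose g a := \sum_(j < p) expQZ R (psi x *+ j ^ 2 *~ a).
have GA a : G A a = g a * G H a.
  rewrite /G (sum_prime_cosets R _ pr_p fD zA pbx Ax bxx) mulr_suml.
  apply: eq_bigr => j _; rewrite mulr_sumr; apply: eq_bigr => t.
  rewrite inE => /andP[_ /eqP bxt].
  rewrite quadraticD // polarMnl // bxt mul0rn addr0 quadraticMn // mulrzDl.
  by rewrite expQZD.
have g1 : g 1 = \sum_(j < p) expQZ R (psi x *+ j ^ 2) by [].
exists k.+1; split.
  rewrite GA normrM exprMn g1 (prime_gauss_norm pr_p p2 R psix ppsix).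
  by rewrite cardA2 EH [RHS]mulrA -exprSr mulrA -exprD.
move=> a ap; rewrite !GA GH // {1}/g (prime_gauss_twist pr_p p2 R psix ppsix) // g1.
by rewrite mulnS exprD mulrACA.
Qed.

(** Comparing the first clause of the descent with [gauss_norm2] gives
    [#|T| = p ^ k' * #|radical psi|] for its exponent [k'], hence [k' = k]. *)
Lemma gauss_twist_odd k (a : int) : #|T| = (p ^ k * #|radical psi|)%N ->
  coprimez a p ->
  gauss R (fun t => psi t *~ a) = (-1) ^+ (ell p a * k) * gauss R psi.
Proof.
move=> cardT ap; have [k' [EA GA]] := odd_twist_exists.
have GE b : G [set: T]%SET b = gauss R (fun t => psi t *~ b).
  by apply: eq_bigl => t; rewrite finset.in_setT.
have GE1 : G [set: T]%SET 1 = gauss R psi by rewrite GE.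
suff -> : k = k' by rewrite -GE GA // GE1.
have p0 : p%:R != 0 :> R[i] by rewrite pnatr_eq0 -lt0n prime_gt0.
have T0 : #|T|%:R != 0 :> R[i].
  by rewrite pnatr_eq0 -lt0n; apply/card_gt0P; exists 0.
move: EA; rewrite GE1 gauss_norm2 //; last exact: odd_tame.
rewrite cardsT expr2 mulrCA => /(mulfI T0); rewrite cardT -natrX -natrM.
move/eqP; rewrite eqr_nat eqn_pmul2r; last first.
  by apply/card_gt0P; exists 0; rewrite inE; apply/forallP => s; rewrite polar0l.
by rewrite eqn_exp2l ?prime_gt1 // => /eqP.
Qed.

End OddTwist.

(** * The hexagonal sum of a symmetric bilinear form on a 2-group *)

Section HexagonalSum.

Variables (R : realType) (T : finZmodType) (b : T -> T -> QmodZ).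
Hypotheses (T2 : (2.-group [set: T])%g) (bb : biadditive b).
Hypothesis bC : forall x y, b x y = b y x.
Implicit Type A : {set T}.

Let Q u v := b u u + b u v + b v v.
Let S A := \sum_(u in A) \sum_(v in A) expQZ R (Q u v).

Let bDl x1 x2 y : b (x1 + x2) y = b x1 y + b x2 y.
Proof. exact: (zmod_morphismD (bb.1 y) x1 x2). Qed.

Let bDr x y1 y2 : b x (y1 + y2) = b x y1 + b x y2.
Proof. exact: (zmod_morphismD (bb.2 x) y1 y2). Qed.

Let QC u v : Q u v = Q v u.
Proof. by rewrite /Q bC addrAC [_ + b u u]addrC addrA. Qed.

Lemma sum_shift_eq0 A x (F : T -> R[i]) z : zmod_closed A -> x \in A ->
  {in A, forall t, F (t + x) = z * F t} -> z != 1 -> \sum_(t in A) F t = 0.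
Proof.
move=> zA Ax Fx z1; set s := LHS; suff /eqP : z * s = s.
  by rewrite -subr_eq0 -{2}[s]mul1r -mulrBl mulf_eq0 subr_eq0 (negPf z1) => /eqP.
rewrite mulr_sumr /s [RHS](reindex_inj (addIr x)).
apply: eq_big => [t|t /Fx //].
apply/idP/idP => h; first exact: zmod_closed_add.
by rewrite -(addrK x t); apply: zA.2.
Qed.

(** Let [H] be the orthogonal of [x] in [A], of index 2. If [b x x = 0], adding [x] to [u]
    multiplies the term by [expQZ R (b x v)], so only [v] in [H] contributes, and then by symmetry
    only [u] in [H]: [S A = S H]. Otherwise [x] splits off, and the four pairs of multiples [0], [x]
    contribute the factor [1 - 1 - 1 - 1 = - 2]. *)
Lemma hexagonal_sum_sign : exists k, #|T|%:R ^+ 2 =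
  (- 2) ^+ k * \sum_u \sum_v expQZ R (b u u + b u v + b v v).
Proof.
suff [k Ek] : exists k, #|[set: T]%SET|%:R ^+ 2 = (- 2) ^+ k * S [set: T]%SET.
  exists k; rewrite -cardsT Ek; congr (_ * _).
  apply: eq_big => [t|t _]; first by rewrite finset.in_setT.
  by apply: eq_bigl => t'; rewrite finset.in_setT.
apply: (bilinear_subgroup_ind (P := fun A => exists k, #|A|%:R ^+ 2 = (- 2) ^+ k * S A)
  T2 (isT : prime 2) bb).
  move=> A zA bA; exists 0%N; rewrite mul1r /S.
  transitivity (\sum_(u in A) #|A|%:R : R[i]).
    by rewrite sumr_const expr2 mulr_natr.
  apply: eq_bigr => u Au; rewrite -sumr_const; apply: eq_bigr => v Av.
  by rewrite /Q !bA // !addr0 expQZ0.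
move=> A x y zA Ax Ay tbx bxy yx [k].
have cardA := card_prime_index R (isT : prime 2) (bDr x) zA tbx Ay bxy.
have zH : zmod_closed [set t in A | b x t == 0] by apply: zmod_closed_ker.
set H := [set t in A | _] in cardA zH *; move=> Ek.
have cardA2 : #|A|%:R ^+ 2 = 2 ^+ 2 * #|H|%:R ^+ 2 :> R[i].
  by rewrite cardA natrM exprMn.
have bx2 t : t \in A -> b x t + b x t = 0 by move/tbx; rewrite mulr2n.
have [bxx|bxx] := eqVneq (b x x) 0; last first.
  rewrite (yx bxx) in Ay bxy cardA => {yx y}.
  have ex : expQZ R (b x x) = -1.
    have : expQZ R (b x x) ^+ 2 == 1 ^+ 2 by rewrite -expQZMn tbx // expQZ0 expr1n.
    by rewrite eqf_sqr expQZ_eq1 (negPf bxx) => /eqP.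
  exists k.+1; suff -> : S A = - 2 * S H.
    rewrite cardA2 Ek (exprSr _ k) mulrCA -(mulrA (_ ^+ k)).
    by rewrite [- 2 * (- 2 * _)]mulrA mulrNN -expr2.
  have e3 : expQZ R (b x x + b x x + b x x) = -1 by rewrite bx2 // add0r.
  have Qx (i j : 'I_2) u v : u \in H -> v \in H ->
      expQZ R (Q (x *+ i + u) (x *+ j + v)) =
      expQZ R (b (x *+ i) (x *+ i) + b (x *+ i) (x *+ j) + b (x *+ j) (x *+ j)) *
      expQZ R (Q u v).
    rewrite !inE => /andP[_ /eqP bu] /andP[_ /eqP bv]; rewrite -expQZD.
    have bn (n : nat) t : b x t = 0 -> b (x *+ n) t = 0.
      by move=> h; rewrite (zmod_morphismMn (bb.1 t)) h mul0rn.
    congr (expQZ R _); rewrite /Q !(bDl, bDr) ![b u (_ *+ _)]bC ![b v (_ *+ _)]bC.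
    rewrite !(bn _ _ bu) !(bn _ _ bv) !addr0 !add0r.
    by rewrite [X in X + (_ + b v v)]addrACA [LHS]addrACA.
  have -> : S A = (\sum_(i < 2) \sum_(j < 2) expQZ R
      (b (x *+ i) (x *+ i) + b (x *+ i) (x *+ j) + b (x *+ j) (x *+ j))) * S H.
    rewrite /S (sum_prime_cosets R _ (isT : prime 2) (bDr x) zA tbx Ax bxx).
    rewrite mulr_suml; apply: eq_bigr => i _.
    rewrite mulr_suml exchange_big /=.
    rewrite (sum_prime_cosets R _ (isT : prime 2) (bDr x) zA tbx Ax bxx).
    apply: eq_bigr => j _; rewrite exchange_big /= mulr_sumr; apply: eq_bigr => u Hu.
    by rewrite mulr_sumr; apply: eq_bigr => v Hv; apply: Qx.
  congr (_ * _); rewrite !big_ord_recl !big_ord0 /= !mulr0n !mulr1n.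
  rewrite !(zmod_morphism0 (bb.1 _)) !(zmod_morphism0 (bb.2 _)) !addr0 !add0r.
  by rewrite e3 ex expQZ0; ring.
have Hx : x \in H by rewrite inE Ax bxx eqxx.
exists k.+2; suff -> : S A = S H by rewrite cardA2 Ek mulrA -sqrrN -exprD.
have Qx u v : u \in A -> Q (u + x) v = Q u v + b x v.
  move=> Au; rewrite /Q !(bDl, bDr) bxx addr0 [b u x]bC.
  rewrite -[b u u + _ + _]addrA bx2 // addr0 addrA.
  by rewrite [RHS]addrAC.
have sumA v : v \in A -> v \notin H -> \sum_(u in A) expQZ R (Q u v) = 0.
  move=> Av; rewrite inE Av /= => bxv.
  apply: (@sum_shift_eq0 A x _ (expQZ R (b x v))) => //.
    by move=> t At; rewrite Qx // expQZD mulrC.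
  by rewrite expQZ_eq1.
have sumH u : u \in A -> u \notin H -> \sum_(v in H) expQZ R (Q u v) = 0.
  move=> Au; rewrite inE Au /= => bxu.
  apply: (@sum_shift_eq0 H x _ (expQZ R (b x u))) => //.
    move=> t; rewrite inE => /andP[At _].
    by rewrite QC Qx // expQZD mulrC [Q t u]QC.
  by rewrite expQZ_eq1.
have subHA t : t \in H -> t \in A by rewrite inE => /andP[].
rewrite /S exchange_big /= (bigID (fun v => v \in H)) /= [X in _ + X]big1 ?addr0; last first.
  by move=> v /andP[]; apply: sumA.
transitivity (\sum_(v in H) \sum_(u in A) expQZ R (Q u v)).
  apply: eq_bigl => v; apply/andP/idP => [[]//|Hv]; split => //; exact: subHA.
rewrite exchange_big /= (bigID (fun v => v \in H)) /= [X in _ + X]big1 ?addr0; last first.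
  by move=> v /andP[]; apply: sumH.
apply: eq_bigl => v; apply/andP/idP => [[]//|Hv]; split => //; exact: subHA.
Qed.

End HexagonalSum.

(** * The quadratic function attached to an integral symmetric matrix *)

Lemma sum_ord_pairs (V : nmodType) n (f : 'I_n -> 'I_n -> V) :
  \sum_i \sum_j f i j = \sum_i f i i + \sum_(i < n) \sum_(j < n | (i < j)%N) (f i j + f j i).
Proof.
have -> : \sum_(i < n) \sum_(j < n | (i < j)%N) (f i j + f j i) =
    \sum_(i < n) \sum_(j < n | (i < j)%N) f i j + \sum_(i < n) \sum_(j < n | (j < i)%N) f i j.
  rewrite [X in _ + X](exchange_big_dep xpredT) //= -big_split /=.
  by apply: eq_bigr => i _; rewrite big_split.
rewrite -!big_split /=; apply: eq_bigr => i _.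
rewrite (bigD1 i) //= (bigID (fun j : 'I_n => (i < j)%N)) /=; congr (_ + (_ + _)).
  by apply: eq_bigl => j; rewrite -(inj_eq val_inj) /=; case: ltngtP.
by apply: eq_bigl => j; rewrite -(inj_eq val_inj) /=; case: ltngtP.
Qed.

Lemma quadratic_sum (U V : zmodType) (q : U -> V) (B : U -> U -> V) n (f : 'I_n -> U) :
  q 0 = 0 -> (forall x y, q (x + y) = q x + q y + B x y) ->
  (forall y, zmod_morphism (B^~ y)) ->
  q (\sum_k f k) = \sum_k q (f k) + \sum_(k < n) \sum_(l < n | (k < l)%N) B (f k) (f l).
Proof.
move=> q0 qD Bl; elim: n f => [|n IH] f; first by rewrite !big_ord0 addr0.
rewrite big_ord_recr qD IH /= [in RHS]big_ord_recr /= -!addrA; congr (_ + _).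
rewrite addrCA; congr (_ + _).
rewrite (zmod_morphism_sum (Bl _)) [RHS]big_ord_recr /= [X in _ = _ + X]big_pred0 ?addr0.
  rewrite addrC -big_split /=; apply: eq_bigr => i _.
  by rewrite [RHS]big_mkcond big_ord_recr /= ltn_ord -big_mkcond addrC.
by move=> j; rewrite ltnNge -ltnS ltn_ord.
Qed.

Lemma sym_mxE (V : Type) n (A : 'M[V]_n) : A^T = A -> forall i j, A j i = A i j.
Proof. by move=> symA i j; rewrite -{1}symA mxE. Qed.

Section MatrixForm.

Variables (T : finZmodType) (psi : T -> QmodZ).

Definition mxform n (A : 'M[int]_n) (t : {ffun 'I_n -> T}) : QmodZ :=
  \sum_i psi (t i) *~ A i i
  + \sum_(i < n) \sum_(j < n | (i < j)%N) polar psi (t i) (t j) *~ A i j.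

Definition mxform_polar n (A : 'M[int]_n) (s t : {ffun 'I_n -> T}) : QmodZ :=
  \sum_i \sum_j polar psi (s i) (t j) *~ A i j.

Definition mxact m n (M : 'M[int]_(m, n)) (t : {ffun 'I_n -> T}) : {ffun 'I_m -> T} :=
  [ffun i => \sum_j t j *~ M i j].

Lemma mxactM m n r (M : 'M[int]_(m, n)) (N : 'M_(n, r)) t :
  mxact (M *m N) t = mxact M (mxact N t).
Proof.
apply/ffunP => i; rewrite !ffunE.
rewrite [RHS](eq_bigr (fun j => \sum_k t k *~ (M i j * N j k))) => [|j _].
  by rewrite exchange_big; apply: eq_bigr => k _; rewrite mxE mulrz_sumr.
by rewrite ffunE mulrz_suml; apply: eq_bigr => k _; rewrite mulrC mulrzA.
Qed.

Lemma mxact_scalar n (d : int) t : mxact (d%:M : 'M_n) t = [ffun i => t i *~ d].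
Proof.
apply/ffunP => i; rewrite !ffunE (bigD1 i) //= mxE eqxx [X in _ + X]big1 ?addr0 //.
by move=> j ji; rewrite mxE eq_sym (negPf ji).
Qed.

(** Composing with the adjugate gives multiplication by [\det M], which is invertible on [T] since
    [#|T|] kills [T]. *)
Lemma mxact_inj n (M : 'M[int]_n) : coprimez (\det M) #|T| -> injective (mxact M).
Proof.
move=> cop s t Est; have := congr1 (mxact (\adj M)) Est.
rewrite -!mxactM mul_adj_mx !mxact_scalar => /ffunP Ed; apply/ffunP => i.
have := Ed i; rewrite !ffunE; have /coprimezP[[u v] /= E] := cop.
move=> Edi; have cl (x : T) : x = x *~ \det M *~ u.
  rewrite -mulrzA -[x in LHS]mulr1z -E mulrzDr [u * _]mulrC.
  by rewrite [X in _ + X]mulrz_card_dvd ?addr0 // dvdz_mull.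
by rewrite [t i]cl -Edi -cl.
Qed.

Hypothesis qpsi : quadratic psi.

Lemma mxform_polar_zmodl n (A : 'M[int]_n) t : zmod_morphism ((mxform_polar A)^~ t).
Proof.
move=> x y; rewrite /mxform_polar -sumrB; apply: eq_bigr => i _.
rewrite -sumrB; apply: eq_bigr => j _; rewrite -mulrzBl; congr (_ *~ _).
by rewrite !ffunE; apply: qpsi.2.1.
Qed.

Lemma mxformD n (A : 'M[int]_n) s t : A^T = A ->
  mxform A (s + t) = mxform A s + mxform A t + mxform_polar A s t.
Proof.
move=> symA; rewrite /mxform_polar sum_ord_pairs [X in _ = X + _]addrACA [RHS]addrACA.
congr (_ + _); rewrite -!big_split /=; apply: eq_bigr => i _.
  by rewrite !ffunE quadraticD // !mulrzDl.
rewrite -!big_split /=; apply: eq_bigr => j _.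
rewrite !ffunE (sym_mxE symA i j) -!mulrzDl; congr (_ *~ _).
rewrite polarDl // !polarDr // [polar psi (s j) (t i)]polarC.
by rewrite [X in _ + X = _]addrC addrACA.
Qed.

Lemma mxform0 n (A : 'M[int]_n) : mxform A 0 = 0.
Proof.
rewrite /mxform !big1 ?addr0 // => i _; rewrite ?ffunE ?quadratic0 ?mul0rz //.
by rewrite big1 // => j _; rewrite ffunE polar0l // mul0rz.
Qed.

Lemma mxform_line n (A : 'M[int]_n) (v : 'I_n -> int) (x : T) : A^T = A ->
  mxform A [ffun i => x *~ v i] = psi x *~ (\sum_i \sum_j v i * A i j * v j).
Proof.
move=> symA; rewrite sum_ord_pairs mulrzDr /mxform !mulrz_sumr.
congr (_ + _); apply: eq_bigr => i _.
  by rewrite ffunE quadraticMz // -mulrzA; congr (_ *~ _); ring.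
rewrite mulrz_sumr; apply: eq_bigr => j _.
rewrite !ffunE (sym_mxE symA i j) polarMzl // polarMzr // polar_xx //.
by rewrite pmulrn -!mulrzA; congr (_ *~ _); ring.
Qed.

(** [mxact M t] is the sum over [k] of the pure tensors of the [k]-th column of [M] with [t k]. The
    form and its polarization on such tensors produce the entries of [M^T *m A *m M]. *)
Lemma mxform_act m n (A : 'M[int]_m) (M : 'M_(m, n)) t : A^T = A ->
  mxform A (mxact M t) = mxform (M^T *m A *m M) t.
Proof.
move=> symA; pose f k : {ffun 'I_m -> T} := [ffun i => t k *~ M i k].
have -> : mxact M t = \sum_k f k.
  by apply/ffunP => i; rewrite ffunE sum_ffunE; apply: eq_bigr => k _; rewrite ffunE.
have entry k l : (M^T *m A *m M) k l = \sum_i \sum_j M i k * A i j * M j l.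
  rewrite mxE exchange_big /=; apply: eq_bigr => j _; rewrite mxE mulr_suml.
  by apply: eq_bigr => i _; rewrite mxE.
rewrite (quadratic_sum (B := mxform_polar A)) ?mxform0 //.
- congr (_ + _); apply: eq_bigr => k _; first by rewrite mxform_line // entry.
  apply: eq_bigr => l _; rewrite entry mulrz_sumr; apply: eq_bigr => i _.
  rewrite mulrz_sumr; apply: eq_bigr => j _; rewrite !ffunE polarMzl // polarMzr //.
  by rewrite -!mulrzA; congr (_ *~ _); ring.
- by move=> x y; apply: mxformD.
- exact: mxform_polar_zmodl.
Qed.

Lemma eq_mxform_mod (W : int) n (A C : 'M[int]_n) t : (forall x, psi x *~ W = 0) ->
  (forall i j, (A i j = C i j %[mod W])%Z) -> mxform A t = mxform C t.
Proof.
move=> psiW AC.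
have E (c : QmodZ) i j : c *~ W = 0 -> c *~ A i j = c *~ C i j.
  move=> cW; apply/eqP; rewrite -subr_eq0 -mulrzBr.
  have /eqP := AC i j; rewrite eqz_mod_dvd => /dvdzP[q ->].
  by rewrite mulrC mulrzA cW mul0rz.
rewrite /mxform; congr (_ + _); apply: eq_bigr => i _; first exact: E.
apply: eq_bigr => j _; apply: E.
by rewrite /polar !mulrzBl !psiW !subr0.
Qed.

End MatrixForm.

(** * Gauss sums of matrix forms: congruence, reduction of entries, block sums *)

Section MatrixGauss.

Variables (R : realType) (T : finZmodType) (psi : T -> QmodZ).
Hypothesis qpsi : quadratic psi.

Lemma gauss_mxform_act n (A M : 'M[int]_n) : A^T = A -> coprimez (\det M) #|T| ->
  gauss R (mxform psi (M^T *m A *m M)) = gauss R (mxform psi A).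
Proof.
move=> symA copM; rewrite /gauss [RHS](reindex_inj (mxact_inj copM)) /=.
by apply: eq_bigr => t _; rewrite mxform_act.
Qed.

Lemma gauss_mxform_mod (W : int) n (A C : 'M[int]_n) : (forall x, psi x *~ W = 0) ->
  (forall i j, (A i j = C i j %[mod W])%Z) ->
  gauss R (mxform psi A) = gauss R (mxform psi C).
Proof. by move=> psiW eqAC; apply: eq_bigr => t _; rewrite (eq_mxform_mod t psiW eqAC). Qed.

Lemma gauss_mxform0 (A : 'M[int]_0) : gauss R (mxform psi A) = 1.
Proof.
have t0 : forall t : {ffun 'I_0 -> T}, t = 0 by move=> t; apply/ffunP => -[].
rewrite /gauss (bigD1 (0 : {ffun 'I_0 -> T})) //=.
rewrite [X in _ + X]big1 => [|t]; last by rewrite (t0 t) eqxx.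
by rewrite mxform0 // expQZ0 addr0.
Qed.

(* A possibly asymmetric form with [psi2 x x = psi x]; it need not be biadditive. *)
Let psi2 x y : QmodZ :=
  if x == y then psi x else if (enum_rank x < enum_rank y)%N then polar psi x y else 0.

Let psi2D x y : psi2 x y + psi2 y x = polar psi x y.
Proof.
rewrite /psi2 eq_sym; case: eqVneq => [->|ne]; first by rewrite polar_xx // mulr2n.
case: ltngtP => [_|_|/ord_inj/enum_rank_inj eq_yx]; rewrite ?addr0 ?add0r //.
  exact: polarC.
by rewrite eq_yx eqxx in ne.
Qed.

(** A full double sum splits directly along the blocks of a matrix, unlike a sum over [i < j]. *)
Let mxformE n (A : 'M[int]_n) t : A^T = A ->
  mxform psi A t = \sum_i \sum_j psi2 (t i) (t j) *~ A i j.
Proof.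
move=> symA; rewrite sum_ord_pairs /mxform; congr (_ + _); apply: eq_bigr => i _.
  by rewrite /psi2 eqxx.
by apply: eq_bigr => j _; rewrite (sym_mxE symA i j) -mulrzDl psi2D.
Qed.

Lemma gauss_mxform_block m n (A : 'M[int]_m) (C : 'M_n) : A^T = A -> C^T = C ->
  gauss R (mxform psi (block_mx A 0 0 C)) = gauss R (mxform psi A) * gauss R (mxform psi C).
Proof.
move=> symA symC.
pose glue (ab : {ffun 'I_m -> T} * {ffun 'I_n -> T}) : {ffun 'I_(m + n) -> T} :=
  [ffun i => match split i with inl j => ab.1 j | inr j => ab.2 j end].
pose cut (t : {ffun 'I_(m + n) -> T}) : {ffun 'I_m -> T} * {ffun 'I_n -> T} :=
  ([ffun i => t (lshift n i)], [ffun i => t (rshift m i)]).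
have gluel ab i : glue ab (lshift n i) = ab.1 i.
  by rewrite ffunE; case: split_ordP => j /eqP; rewrite (eq_lshift, eq_lrshift) // => /eqP ->.
have gluer ab i : glue ab (rshift m i) = ab.2 i.
  by rewrite ffunE; case: split_ordP => j /eqP; rewrite (eq_rshift, eq_rlshift) // => /eqP ->.
have glueK : cancel glue cut.
  by case=> s t; congr pair; apply/ffunP => i; rewrite ffunE (gluel, gluer).
have cutK : cancel cut glue.
  move=> t; apply/ffunP => i; rewrite ffunE.
  by case: split_ordP => j ->; rewrite ffunE.
rewrite /gauss big_distrlr pair_big /=.
rewrite (reindex glue) /=; last by exists cut => ? _; rewrite (glueK, cutK).
apply: eq_bigr => -[s t] _; rewrite -expQZD; congr (expQZ R _).
have sym : (block_mx A 0 0 C)^T = block_mx A 0 0 C.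
  by rewrite tr_block_mx symA symC !trmx0.
rewrite !mxformE // big_split_ord /=; congr (_ + _); apply: eq_bigr => i _.
  rewrite big_split_ord /= [X in _ + X]big1 ?addr0 => [|j _]; last first.
    by rewrite block_mxEur mxE mulr0z.
  by apply: eq_bigr => j _; rewrite block_mxEul !gluel.
rewrite big_split_ord /= [X in X + _]big1 ?add0r => [|j _]; last first.
  by rewrite block_mxEdl mxE mulr0z.
by apply: eq_bigr => j _; rewrite block_mxEdr !gluer.
Qed.

Lemma gauss_mxform_scalar (a : int) :
  gauss R (mxform psi (a%:M : 'M_1)) = gauss R (fun x => psi x *~ a).
Proof.
pose cst x : {ffun 'I_1 -> T} := [ffun=> x].
rewrite /gauss (reindex cst) /=; last first.
  exists (fun t => t 0) => [x _|t _]; first by rewrite ffunE.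
  by apply/ffunP => i; rewrite ffunE (ord1 i).
apply: eq_bigr => x _; rewrite /mxform !big_ord1 big_pred0 => [|j]; last by case: j => -[].
by rewrite ffunE mxE eqxx addr0.
Qed.

Lemma gauss_mxform_hexagonal :
  gauss R (mxform psi (block_mx 2%:M 1%:M 1%:M 2%:M : 'M_(1 + 1))) =
  \sum_x \sum_y expQZ R (polar psi x x + polar psi x y + polar psi y y).
Proof.
rewrite pair_big /=.
pose glue (ab : T * T) : {ffun 'I_(1 + 1) -> T} :=
  [ffun i => if i == lshift 1 ord0 then ab.1 else ab.2].
rewrite /gauss (reindex glue) /=; last first.
  exists (fun t => (t (lshift 1 ord0), t (rshift 1 ord0))) => [[x y] _|t _].
    by rewrite !ffunE.
  apply/ffunP => i; rewrite ffunE; case: eqVneq => [-> //|].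
  case: (split_ordP i) => j ->; rewrite (ord1 j) //=.
apply: eq_bigr => -[x y] _; congr (expQZ R _).
rewrite mxformE; last by rewrite tr_block_mx !tr_scalar_mx.
rewrite !big_split_ord /= !big_ord1 !big_split_ord /= !big_ord1 !ffunE /=.
rewrite block_mxEul block_mxEur block_mxEdl block_mxEdr !mxE eqxx !mulr1n.
rewrite /psi2 !eqxx -/(psi2 x y) -/(psi2 y x).
rewrite -!pmulrn !mulr1n -!polar_xx //.
by rewrite addrA -[_ + psi2 x y + _]addrA psi2D.
Qed.

End MatrixGauss.

(** * Block decomposition of symmetric integer matrices at a prime *)

Lemma det_mx2 (K : comPzRingType) (A : 'M[K]_2) :
  \det A = A 0 0 * A 1 1 - A 0 1 * A 1 0.
Proof.
rewrite (expand_det_row _ 0) big_ord_recl big_ord1 /cofactor !det_mx11 !mxE.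
have -> : lift 0 0 = 1 :> 'I_2 by apply: val_inj.
have -> : lift 1 0 = 0 :> 'I_2 by apply: val_inj.
by rewrite /= expr0 expr1 mul1r mulN1r mulrN.
Qed.

Section SymmetricIntegerMatrices.

Variable p : nat.
Hypothesis pr_p : prime p.

Lemma coprimez_primeE (a : int) : coprimez a p = ~~ (p %| a)%Z.
Proof. by rewrite coprimez_sym coprimezE dvdzE prime_coprime. Qed.

Lemma trmx_congr n m (A : 'M[int]_n) (M : 'M_(n, m)) :
  A^T = A -> (M^T *m A *m M)^T = M^T *m A *m M.
Proof. by move=> symA; rewrite !trmx_mul trmxK symA mulmxA. Qed.

Lemma det_congr n (A M : 'M[int]_n) : \det (M^T *m A *m M) = \det M ^+ 2 * \det A.
Proof. by rewrite !det_mulmx det_tr expr2; ring. Qed.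

(* Completing the square, with denominators cleared. *)
Lemma split_off_block k m (E : 'M[int]_k) (r : 'M_(k, m)) (D : 'M_m) :
  E^T = E -> D^T = D ->
  exists M : 'M[int]_(k + m), exists C : 'M[int]_m,
    [/\ \det M = \det E ^+ m, C^T = C &
        M^T *m block_mx E r r^T D *m M = block_mx E 0 0 C].
Proof.
move=> symE symD; pose M := block_mx 1%:M (- (\adj E *m r)) 0 (\det E)%:M.
exists M; set B := block_mx E r r^T D.
have symB : B^T = B by rewrite tr_block_mx symE symD trmxK.
have BM : B *m M = block_mx E 0 r^T (- (r^T *m (\adj E *m r)) + D *m (\det E)%:M).
  rewrite mulmx_block !mulmx1 !mulmx0 !addr0 mulmxN mulmxN mulmxA mul_mx_adj.
  by rewrite mul_scalar_mx mul_mx_scalar addNr.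
set C0 := - _ + _ in BM; pose C := (\det E)%:M *m C0.
have [L EL] : exists L, M^T *m B *m M = block_mx E 0 L C.
  rewrite -mulmxA BM tr_block_mx trmx0 trmx1 tr_scalar_mx mulmx_block.
  rewrite !mul1mx !mul0mx !addr0 mulmx0 add0r; eexists; reflexivity.
have := trmx_congr M symB; rewrite EL tr_block_mx trmx0 => /eq_block_mx[_ L0 _ symC].
exists C; split=> //; first by rewrite det_ublock det1 mul1r det_scalar.
by rewrite -[L]trmxK L0 trmx0.
Qed.

Lemma prime_dvd_det n (A : 'M[int]_n.+1) :
  (forall j, (p %| A ord0 j)%Z) -> (p %| \det A)%Z.
Proof.
move=> pA; rewrite (expand_det_row _ ord0); apply: rpred_sum => j _.
by rewrite dvdz_mulr.
Qed.

(** The off-diagonal entry is left arbitrary because the decomposition is carried out exactly over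
    the integers; an odd [c] can be scaled to 1 only modulo a power of 2. *)
Definition even_block (m1 c m2 : int) : 'M[int]_(1 + 1) :=
  block_mx (2 * m1)%:M c%:M c%:M (2 * m2)%:M.

Lemma even_blockE m1 c m2 (i j : 'I_2) :
  even_block m1 c m2 i j = if i == j then (if i == 0 then 2 * m1 else 2 * m2) else c.
Proof.
rewrite /even_block; case: (@split_ordP 1 1 i) => i' ->; case: (@split_ordP 1 1 j) => j' ->;
rewrite (ord1 i') (ord1 j') ?(block_mxEul, block_mxEur, block_mxEdl, block_mxEdr) mxE /=;
by rewrite ?mulr1n.
Qed.

Lemma det_even_block m1 c m2 : \det (even_block m1 c m2) = 4 * m1 * m2 - c ^+ 2.
Proof. by rewrite det_mx2 !even_blockE /=; ring. Qed.

(** Adding the [j]-th basis vector to the first one: for odd [p], if [p] divides the diagonal but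
    not [A ord0 j], the new corner entry is prime to [p]. *)
Lemma congr_shear00 n (A : 'M[int]_n.+1) j : A^T = A ->
  let M := 1%:M + delta_mx j ord0 in
  (M^T *m A *m M) ord0 ord0 = A ord0 ord0 + 2 * A ord0 j + A j j.
Proof.
move=> symA M.
have mulD (X : 'M[int]_n.+1) k : (X *m delta_mx j ord0) k ord0 = X k j.
  rewrite mxE (bigD1 j) //= mxE !eqxx mulr1 big1 ?addr0 // => l lj.
  by rewrite mxE (negPf lj) mulr0.
have mulDt (X : 'M[int]_n.+1) k : (delta_mx ord0 j *m X) ord0 k = X j k.
  by rewrite -{1}(trmxK X) -trmx_delta -trmx_mul [LHS]mxE mulD mxE.
have EM : M^T = 1%:M + delta_mx ord0 j by rewrite /M linearD /= trmx1 trmx_delta.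
have row0 k : (M^T *m A) ord0 k = A ord0 k + A j k.
  by rewrite EM mulmxDl mul1mx [LHS]mxE mulDt.
by rewrite {2}/M mulmxDr mulmx1 [LHS]mxE mulD !row0 (sym_mxE symA ord0 j); ring.
Qed.

Lemma det_shear n (j : 'I_n.+1) : j != ord0 ->
  \det (1%:M + delta_mx j ord0 : 'M[int]_n.+1) = 1.
Proof.
move=> j0; rewrite det_trig.
  by rewrite big1 // => i _; rewrite !mxE eqxx; case: eqVneq => // ->; rewrite (negPf j0).
apply/is_trig_mxP => k l kl; rewrite !mxE -(inj_eq val_inj) /= (ltn_eqF kl).
by case: (k =P j) kl => // ->; case: eqP => // ->; rewrite ltn0.
Qed.

Variable P : forall n, 'M[int]_n -> Prop.
Hypothesis P0 : forall A : 'M_0, P A.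
Hypothesis P1 : forall n (a : int) (A : 'M_n), A^T = A ->
  coprimez a p -> coprimez (\det A) p -> P A -> @P (1 + n) (block_mx a%:M 0 0 A).
Hypothesis P2 : p = 2%N -> forall n (m1 c m2 : int) (A : 'M_n), A^T = A ->
  coprimez c p -> coprimez (\det A) p -> P A ->
  @P (1 + 1 + n) (block_mx (even_block m1 c m2) 0 0 A).
Hypothesis Pact : forall n (A M : 'M_n), A^T = A -> coprimez (\det M) p ->
  P (M^T *m A *m M) -> P A.

Let P_tperm n (A : 'M_n) i j : A^T = A -> coprimez (\det A) p ->
  (forall A' : 'M_n, A'^T = A' -> coprimez (\det A') p ->
     (forall k l, A' k l = A (tperm i j k) (tperm i j l)) -> P A') -> P A.
Proof.
move=> symA copA H; pose M : 'M[int]_n := tperm_mx i j.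
have copM : coprimez (\det M) p.
  by rewrite /M det_perm coprimezE abszX /= exp1n coprime1n.
apply: (Pact (M := M)) => //; apply: H; first exact: trmx_congr.
  by rewrite det_congr coprimezMl copA coprimezXl.
by move=> k l; rewrite tr_tperm_mx -xrowE -xcolE !mxE.
Qed.

Let P_corner k m (A : 'M_(k + m)) : A^T = A -> coprimez (\det A) p ->
  coprimez (\det (ulsubmx A)) p ->
  (forall C : 'M_m, C^T = C -> coprimez (\det C) p -> P (block_mx (ulsubmx A) 0 0 C)) ->
  P A.
Proof.
move=> symA copA copE H.
have symE : (ulsubmx A)^T = ulsubmx A by rewrite trmx_ulsub symA.
have symD : (drsubmx A)^T = drsubmx A by rewrite trmx_drsub symA.
have [M [C [detM symC EM]]] := split_off_block (ursubmx A) symE symD.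
rewrite trmx_ursub symA submxK in EM.
have copM : coprimez (\det M) p by rewrite detM coprimezXl.
apply: (Pact (M := M)) => //; rewrite EM; apply: H => //.
have := det_congr A M; rewrite EM det_ublock => Edet.
have : coprimez (\det (ulsubmx A) * \det C) p.
  by rewrite Edet coprimezMl copA coprimezXl.
by rewrite coprimezMl => /andP[].
Qed.

(** A pivot block of determinant prime to [p] is moved to the corner and split off. It is a diagonal
    entry if one is prime to [p]. If not, some [A 0 j] is, since [\det A] is. For odd [p] a shear
    then creates a diagonal pivot; for [p = 2] the rows 0 and [j] give a block with even diagonal
    and odd determinant. As an induction principle this serves both the formula for odd [p] and the
    reduction at 2. *)
Lemma symmetric_int_ind n (A : 'M_n) : A^T = A -> coprimez (\det A) p -> P A.
Proof.
have [m] := ubnP n; elim: m n A => // m IH [|n] A ltnm symA copA; first exact: P0.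
have Pdiag (A' : 'M_n.+1) i : A'^T = A' -> coprimez (\det A') p -> coprimez (A' i i) p -> P A'.
  move=> symA' copA' copi; apply: (P_tperm (i := 0) (j := i)) => // A2 symA2 copA2 EA2.
  have a00 : ulsubmx (A2 : 'M_(1 + n)) = (A' i i)%:M.
    by rewrite [LHS]mx11_scalar !mxE EA2 (_ : lshift n 0 = 0) ?tpermL //; apply: val_inj.
  apply: (@P_corner 1 n) => //; rewrite a00 ?det_scalar1 // => C symC copC.
  by apply: P1 => //; apply: IH.
have [i copi|nodiag] := pickP (fun i => coprimez (A i i) p); first exact: (Pdiag A i).
have pdiag i : (p %| A i i)%Z by have := nodiag i; rewrite coprimez_primeE => /negbFE.
have [j cop0j|norow] := pickP (fun j => coprimez (A 0 j) p); last first.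
  move: copA; rewrite coprimez_primeE prime_dvd_det // => j.
  by have := norow j; rewrite coprimez_primeE => /negbFE.
have j0 : j != 0 by apply: contraTneq cop0j => ->; rewrite nodiag.
have copM : coprimez (\det (1%:M + delta_mx j ord0 : 'M[int]_n.+1)) p.
  by rewrite det_shear // coprimezE coprime1n.
have [p2|p2] := eqVneq p 2%N; last first.
  apply: (Pact symA copM); apply: (Pdiag _ 0); first exact: trmx_congr.
    by rewrite det_congr coprimezMl copA coprimezXl.
  rewrite congr_shear00 // coprimez_primeE.
  rewrite (rpredDr _ (pdiag j)) (rpredDl _ (pdiag 0)) -coprimez_primeE.
  by rewrite coprimezMl cop0j andbT coprimez_sym coprimezE prime_coprime // dvdn_prime2.
case: n => [|n] in A symA copA ltnm Pdiag nodiag pdiag j cop0j j0 copM *.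
  by rewrite (ord1 j) eqxx in j0.
apply: (P_tperm (i := lift ord0 ord0) (j := j)) => // A' symA' copA' EA'.
have E0 : tperm (lift ord0 ord0) j ord0 = ord0 by rewrite tpermD.
have E1 : tperm (lift ord0 ord0) j (lift ord0 ord0) = j by rewrite tpermL.
have [m1 Em1] : exists m1, A' 0 0 = 2 * m1.
  by rewrite EA' E0; have /dvdzP[q ->] := pdiag 0; exists q; rewrite p2 mulrC.
have [m2 Em2] : exists m2, A' (lift ord0 ord0) (lift ord0 ord0) = 2 * m2.
  by rewrite EA' E1; have /dvdzP[q ->] := pdiag j; exists q; rewrite p2 mulrC.
have E01 : A' 0 (lift ord0 ord0) = A 0 j by rewrite EA' E0 E1.
have ul : ulsubmx (A' : 'M_(1 + 1 + n)) = even_block m1 (A 0 j) m2.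
  have L0 : lshift n (0 : 'I_(1 + 1)) = ord0 by apply: val_inj.
  have L1 : lshift n (1 : 'I_(1 + 1)) = lift ord0 ord0 by apply: val_inj.
  have I2 (i : 'I_2) : i = 0 \/ i = 1.
    by case: i => -[|[|//]] lt; [left | right]; apply: val_inj.
  apply/matrixP => i k; rewrite even_blockE !mxE.
  by case: (I2 i) => ->; case: (I2 k) => ->; rewrite /= ?L0 ?L1 ?(sym_mxE symA' 0) ?E01.
apply: (@P_corner (1 + 1) n) => //.
  rewrite ul det_even_block coprimez_primeE rpredBl; last first.
    by rewrite p2 -mulrA dvdz_mulr.
  by rewrite -coprimez_primeE coprimezXl.
move=> C symC copC; rewrite ul; apply: P2 => //; apply: IH => //.
by move: ltnm; rewrite ltnS; apply: ltnW.
Qed.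

End SymmetricIntegerMatrices.

(** * Phases of nonzero complex numbers *)

Section Phases.

Variable R : realType.
Implicit Types (z w : R[i]) (x y : QmodZ).

(** A relation that can be multiplied and divided without first choosing a phase. The nonvanishing
    makes [x] unique and ties the relation to [phase]. *)
Definition has_phase z x := z != 0 /\ z = `|z| * expQZ R x.

Lemma has_phase_inj z x y : has_phase z x -> has_phase z y -> x = y.
Proof.
move=> [z0 Ex] [_ Ey]; apply: (@expQZ_inj R); rewrite -normr_eq0 in z0.
by apply: (mulfI z0); rewrite -Ex -Ey.
Qed.

Lemma phase_eq (X : finType) (psi : X -> QmodZ) x :
  has_phase (gauss R psi) x -> phase R psi = x.
Proof.
move=> hx; apply: has_phase_inj (hx); split; first exact: hx.1.
pose S := [set y | gauss R psi = `|gauss R psi| * expQZ R y]%classic.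
by apply: (@xgetPex _ 0 S); exists x; apply: hx.2.
Qed.

Lemma has_phase1 : has_phase 1 0.
Proof. by split; rewrite ?oner_neq0 // normr1 expQZ0 mulr1. Qed.

Lemma has_phaseM z w x y : has_phase z x -> has_phase w y -> has_phase (z * w) (x + y).
Proof.
move=> [z0 Ez] [w0 Ew]; split; first by rewrite mulf_neq0.
by rewrite normrM expQZD mulrACA -Ez -Ew.
Qed.

Lemma has_phaseX z x n : has_phase z x -> has_phase (z ^+ n) (x *+ n).
Proof.
move=> zx; elim: n => [|n IH]; first by rewrite expr0 mulr0n; apply: has_phase1.
by rewrite exprS mulrS; apply: has_phaseM.
Qed.

Lemma has_phase_divr z w x y : has_phase (z * w) x -> has_phase w y -> has_phase z (x - y).
Proof.
move=> [zw0 Ezw] [w0 Ew]; move: (zw0); rewrite mulf_eq0 negb_or => /andP[z0 _].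
split=> //; apply: (mulIf w0).
by rewrite {1}Ezw normrM [in RHS]Ew mulrACA -expQZD subrK.
Qed.

Lemma has_phase_conj z x : has_phase z x -> has_phase z^* (- x).
Proof.
move=> [z0 Ez]; split; first by rewrite conjC_eq0.
by rewrite norm_conjC expQZN -conjCE {1}Ez rmorphM /= (geC0_conj (normr_ge0 _)).
Qed.

Lemma has_phase_sign n : has_phase ((-1) ^+ n) (toQmodZ (n%:R / 2)).
Proof.
by split; rewrite ?signr_eq0 // normrX normrN1 expr1n mul1r expQZ_halfn.
Qed.

Lemma has_phase_pos z : 0 < z -> has_phase z 0.
Proof. by move=> z0; split; [rewrite gt_eqF | rewrite gtr0_norm // expQZ0 mulr1]. Qed.

(** [z] divided by its absolute value is an eighth root of unity, hence a power of the primitive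
    root of phase [1 / 8]. *)
Lemma has_phase8 z : z != 0 -> z ^+ 8 = `|z| ^+ 8 ->
  exists x, has_phase z x /\ x *+ 8 = 0.
Proof.
move=> z0 z8; pose c := toQmodZ (1 / 8).
have nz0 : `|z| != 0 by rewrite normr_eq0.
have c8 : c *+ 8 = 0 by apply/eqP; rewrite -raddfMn toQmodZ_eq0.
have prim : 8.-primitive_root (expQZ R c).
  apply/andP; split=> //; apply/forallP => i; rewrite unity_rootE -expQZMn expQZ_eq1.
  rewrite /c -raddfMn mul1r -(mulr_natl _ i.+1) toQmodZ_muln_eq0 //.
  by case: i; do 8![case=> //].
have w8 : (z / `|z|) ^+ 8 = 1 by rewrite expr_div_n z8 divff // expf_neq0.
have [j Ej] := prim_rootP prim w8.
exists (c *+ j); split; last by rewrite mulrnAC c8 mul0rn.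
by split=> //; rewrite expQZMn -Ej mulrC divfK.
Qed.

Lemma toQmodZ_half_mod m n : m = n %[mod 2] -> toQmodZ (m%:R / 2) = toQmodZ (n%:R / 2).
Proof.
move=> mn; apply: (@expQZ_inj R); rewrite !expQZ_halfn.
by rewrite -signr_odd -[in RHS]signr_odd -!modn2 mn.
Qed.

Lemma toQmodZ_halfD m n :
  toQmodZ ((m + n)%:R / 2) = toQmodZ (m%:R / 2) + toQmodZ (n%:R / 2).
Proof. by rewrite natrD mulrDl raddfD. Qed.

End Phases.

(** * The formula for odd [p] *)

Section OddFormula.

Variables (R : realType) (p : nat) (T : finZmodType) (psi : T -> QmodZ) (k : nat).
Hypotheses (pr_p : prime p) (p2 : p != 2%N) (pT : (p.-group [set: T])%g).
Hypotheses (qpsi : quadratic psi) (cardT : #|T| = (p ^ k * #|radical psi|)%N).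

Let gauss0 : gauss R psi != 0.
Proof. by apply: gauss_neq0 => //; apply: odd_tame pr_p p2 pT qpsi. Qed.

Lemma gauss_conj (X : finType) (q : X -> QmodZ) :
  gauss R (fun x => - q x) = (gauss R q)^*.
Proof. by rewrite rmorph_sum; apply: eq_bigr => x _; rewrite expQZN -conjCE. Qed.

(** The twist by [-1] conjugates the sum and, [-1] being prime to [p], changes it at most by a sign.
    So its square is real up to sign equal to the squared absolute value, and fourth powers
    agree. *)
Lemma has_phase_gauss_odd : exists x, has_phase (gauss R psi) x /\ x *+ 8 = 0.
Proof.
apply: has_phase8 => //; set z := gauss R psi.
have [n En] : exists n, z^* = (-1) ^+ n * z.
  exists (ell p (- 1) * k)%N; rewrite -gauss_conj.
  rewrite -(gauss_twist_odd R pr_p p2 pT qpsi cardT (a := -1)) //.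
  by rewrite coprimezE coprime1n.
have : `|z| ^+ 2 ^+ 2 = z ^+ 2 ^+ 2.
  by rewrite normCK En mulrCA -expr2 exprMn sqrr_sign mul1r.
by rewrite -!exprM => E4; rewrite (exprM z 4 2) -E4 -exprM.
Qed.

Lemma coprimez_cardT d : coprimez d p -> coprimez d #|T|.
Proof.
move=> dp; have /p_natP[N] := pT; rewrite cardsT => ->.
by rewrite coprimezE coprimeXr.
Qed.

Lemma has_phase_mxform_odd n (A : 'M[int]_n) x : A^T = A -> coprimez (\det A) p ->
  has_phase (gauss R psi) x ->
  has_phase (gauss R (mxform psi A)) (x *+ n + toQmodZ ((ell p (\det A) * k)%:R / 2)).
Proof.
move=> symA copA hx; move: n A symA copA.
(* The coprimality of [\det A] is put into [P], as the congruence step of the induction does not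
   provide it. *)
pose P n (A : 'M[int]_n) := coprimez (\det A) p ->
  has_phase (gauss R (mxform psi A)) (x *+ n + toQmodZ ((ell p (\det A) * k)%:R / 2)).
suff H n (A : 'M_n) : A^T = A -> coprimez (\det A) p -> P n A.
  by move=> n A symA copA; apply: H.
apply: (symmetric_int_ind pr_p (P := P)) => {n A}.
- move=> A _; rewrite gauss_mxform0 // det_mx00.
  have -> : ell p 1 = 0%N by rewrite -(expr1n int 2) ell_odd_sqr // coprimezE coprime1n.
  by rewrite mul0n mul0r mulr0n (raddf0 toQmodZ) addr0; apply: has_phase1.
- move=> n a A symA copa copA IH _.
  rewrite gauss_mxform_block ?tr_scalar_mx // gauss_mxform_scalar.
  rewrite (gauss_twist_odd R pr_p p2 pT qpsi cardT copa) det_lblock det_scalar1.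
  have -> : toQmodZ ((ell p (a * \det A) * k)%:R / 2) =
      toQmodZ ((ell p a * k)%:R / 2) + toQmodZ ((ell p (\det A) * k)%:R / 2).
    rewrite -toQmodZ_halfD -mulnDl; apply: (toQmodZ_half_mod R).
    by rewrite -modnMml ell_oddM // modnMml.
  rewrite add1n mulrS [X in has_phase _ X]addrACA [x + toQmodZ _]addrC.
  by do 2?[apply: has_phaseM]; [exact: has_phase_sign | | exact: IH].
- by move=> p_eq2; case/eqP: p2.
move=> n A M symA copM IH copA.
have copMA : coprimez (\det (M^T *m A *m M)) p by rewrite det_congr coprimezMl copA coprimezXl.
have := IH copMA; rewrite gauss_mxform_act //; last exact: coprimez_cardT.
suff -> : toQmodZ ((ell p (\det (M^T *m A *m M)) * k)%:R / 2) =
  toQmodZ ((ell p (\det A) * k)%:R / 2) by [].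
apply: (toQmodZ_half_mod R); rewrite det_congr -modnMml ell_oddM ?coprimezXl //.
by rewrite ell_odd_sqr // modnMml.
Qed.

End OddFormula.

(** * Explicit congruences between forms of rank 3 *)

Definition mx3 (r0 r1 r2 : seq int) : 'M[int]_3 :=
  \matrix_(i, j) nth 0 (nth [::] [:: r0; r1; r2] i) j.

Lemma det_mx3 (A : 'M[int]_3) :
  \det A = A 0 0 * (A 1 1 * A 2 2 - A 1 2 * A 2 1)
         - A 0 1 * (A 1 0 * A 2 2 - A 1 2 * A 2 0)
         + A 0 2 * (A 1 0 * A 2 1 - A 1 1 * A 2 0).
Proof.
have L (i : 'I_3) (j : 'I_2) (k : 'I_3) : val k = bump i j -> lift i j = k.
  by move=> E; apply: val_inj.
rewrite (expand_det_row _ 0) !big_ord_recl big_ord0 /cofactor !det_mx2 !mxE.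
rewrite !(L 0 0 1) // !(L 0 1 2) // !(L 1 0 0) // !(L 1 1 2) // !(L 0 (lift 0 0) 2) //.
rewrite !(L 2 0 0) // !(L 2 1 1) //= /bump /=.
by ring.
Qed.

Lemma block_mx3 (a b c d : int) :
  block_mx (block_mx a%:M b%:M b%:M d%:M : 'M_(1 + 1)) 0 0 c%:M =
  mx3 [:: a; b; 0] [:: b; d; 0] [:: 0; 0; c] :> 'M_(1 + 1 + 1).
Proof.
apply/matrixP => i j; rewrite [RHS]mxE.
case: (@split_ordP (1 + 1) 1 i) => i1 ->; case: (@split_ordP (1 + 1) 1 j) => j1 ->;
rewrite ?(block_mxEul, block_mxEur, block_mxEdl, block_mxEdr) ?(ord1 i1) ?(ord1 j1);
try (case: (@split_ordP 1 1 i1) => i2 ->); try (case: (@split_ordP 1 1 j1) => j2 ->);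
rewrite ?(block_mxEul, block_mxEur, block_mxEdl, block_mxEdr) ?(ord1 i2) ?(ord1 j2) mxE //=.
Qed.

Section SmallForms.

Variables (R : realType) (T : finZmodType) (psi : T -> QmodZ).
Hypothesis qpsi : quadratic psi.

Let G a := gauss R (fun x => psi x *~ a).

Lemma gauss_mx3 (a b c d : int) :
  gauss R (mxform psi (mx3 [:: a; b; 0] [:: b; d; 0] [:: 0; 0; c])) =
  gauss R (mxform psi (block_mx a%:M b%:M b%:M d%:M : 'M_(1 + 1))) * G c.
Proof.
rewrite -block_mx3 /G -gauss_mxform_scalar.
apply: (@gauss_mxform_block R T psi qpsi (1 + 1) 1); last exact: tr_scalar_mx.
by rewrite tr_block_mx !tr_scalar_mx.
Qed.

Lemma gauss_diag2 (a d : int) :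
  gauss R (mxform psi (block_mx a%:M 0%:M 0%:M d%:M : 'M_(1 + 1))) = G a * G d.
Proof.
have z : 0%:M = 0 :> 'M[int]_1 by apply/matrixP => i j; rewrite !mxE mul0rn.
rewrite z (@gauss_mxform_block R T psi qpsi 1 1) ?tr_scalar_mx //.
by rewrite !gauss_mxform_scalar.
Qed.

Lemma gauss_scale_sqr (a c : int) : coprimez c #|T| -> G (a * c ^+ 2) = G a.
Proof.
move=> cT; rewrite /G -!gauss_mxform_scalar.
rewrite -[RHS](@gauss_mxform_act R T psi qpsi 1 _ c%:M) ?tr_scalar_mx ?det_scalar1 //.
by rewrite -!scalar_mxM; congr (gauss R (mxform psi _%:M)); ring.
Qed.

Lemma gauss_cube : coprimez 3 #|T| ->
  G 1 ^+ 3 = G 3 * gauss R (mxform psi (block_mx 2%:M 1%:M 1%:M 2%:M : 'M_(1 + 1))).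
Proof.
(* The columns are [(1, -1, 0)] and [(0, -1, 1)], a basis of the hexagonal lattice orthogonal to
   [(1, 1, 1)], and [(1, 1, 1)] itself, of norm 3. They span a sublattice of index 3, which is prime
   to [#|T|]. *)
move=> cop; pose M := mx3 [:: 1; 0; 1] [:: -1; -1; 1] [:: 0; 1; 1].
pose I := mx3 [:: 1; 0; 0] [:: 0; 1; 0] [:: 0; 0; 1].
have symI : I^T = I.
  by apply/matrixP => i j; rewrite !mxE; case: i => -[|[|[|//]]] ?; case: j => -[|[|[|//]]] ?.
have EM : M^T *m I *m M = mx3 [:: 2; 1; 0] [:: 1; 2; 0] [:: 0; 0; 3].
  apply/matrixP => i j; rewrite !mxE !big_ord_recl big_ord0 !mxE !big_ord_recl !big_ord0 !mxE.
  by case: i => -[|[|[|//]]] ?; case: j => -[|[|[|//]]] ?.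
have copM : coprimez (\det M) #|T|.
  rewrite det_mx3 !mxE /=.
  by rewrite (_ : _ + _ = - 3) ?coprimezE //; move: cop; rewrite coprimezE.
have := gauss_mxform_act R qpsi symI copM.
by rewrite EM !gauss_mx3 gauss_diag2 [G 3 * _]mulrC => ->; rewrite !exprS expr0 mulr1 mulrA.
Qed.

Lemma gauss_pseudo_hyp (m1 m2 : int) (a := 2 * m1 + 1) (b := 2 * m2 + 1)
    (d := 4 * m1 * m2 - 1) : coprimez a #|T| -> coprimez b #|T| ->
  gauss R (mxform psi (block_mx (2 * m1)%:M 1%:M 1%:M (2 * m2)%:M : 'M_(1 + 1))) * G 1 =
  G a * G b * G (a * b * d).
Proof.
move=> copa copb.
(* The first two columns are orthogonal for [B], of odd norms [a] and [b] thanks to the summand 1.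
   The third is orthogonal to both: up to sign it is the cross product of their images
   [(2 * m1, 1, 1)] and [(1, 2 * m2, -1)] under [B]. Its norm is then forced by the determinants. *)
pose M := mx3 [:: 1; 0; b] [:: 0; 1; - a] [:: 1; -1; a - 2 * m1 * b].
pose B := mx3 [:: 2 * m1; 1; 0] [:: 1; 2 * m2; 0] [:: 0; 0; 1].
have symB : B^T = B.
  by apply/matrixP => i j; rewrite !mxE; case: i => -[|[|[|//]]] ?; case: j => -[|[|[|//]]] ?.
have EM : M^T *m B *m M = mx3 [:: a; 0; 0] [:: 0; b; 0] [:: 0; 0; a * b * d].
  apply/matrixP => i j; rewrite !mxE !big_ord_recl big_ord0 !mxE !big_ord_recl !big_ord0 !mxE.
  by case: i => -[|[|[|//]]] ?; case: j => -[|[|[|//]]] ?; rewrite /= /d /a /b; ring.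
have copM : coprimez (\det M) #|T|.
  rewrite det_mx3 !mxE /= (_ : _ + _ = - (a * b)); last by rewrite /a /b; ring.
  by rewrite coprimez_sym coprimezN coprimez_sym coprimezMl copa copb.
have := gauss_mxform_act R qpsi symB copM.
by rewrite EM !gauss_mx3 gauss_diag2 => ->.
Qed.

End SmallForms.

(** * Odd integers modulo powers of 2, and twists on a 2-group *)

Lemma odd_intP (a : int) : coprimez a 2 -> exists w, a = 2 * w + 1.
Proof.
rewrite (coprimez_primeE (isT : prime 2)) => a2; exists (a %/ 2)%Z.
rewrite {1}(divz_eq a 2) mulrC; congr (_ + _).
have : (0 <= a %% 2 < 2)%Z by rewrite modz_ge0 // ltz_pmod.
have : (a %% 2)%Z != 0 by apply: contraNneq a2 => /dvdz_mod0P.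
by case: (a %% 2)%Z => // m; do 2?[case: m => [|m] //].
Qed.

Lemma odd_int_mod8 (a : int) : coprimez a 2 ->
  exists2 r : nat, r \in [:: 1; 3; 5; 7]%N & (a = r %[mod 8])%Z.
Proof.
rewrite (coprimez_primeE (isT : prime 2)) => a2; exists `|(a %% 8)%Z|%N.
  have : (0 <= a %% 8 < 8)%Z by rewrite modz_ge0 // ltz_pmod.
  have : ~~ (2 %| a %% 8)%Z.
    apply: contra a2 => h; rewrite (divz_eq a 8) rpredD // dvdz_mull // dvdzE.
  by case: (a %% 8)%Z => // m; do 8?[case: m => [|m] //].
by rewrite gez0_abs ?modz_mod // modz_ge0.
Qed.

(** Hensel lifting at 2, with the accuracy kept three steps ahead. If [2 ^+ N.+3] divides
    [a - c ^+ 2] with odd quotient, replacing [c] by [c + 2 ^+ N.+2] changes the square by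
    [c * 2 ^+ N.+3] modulo [2 ^+ N.+4], and [c] is odd. *)
Lemma one_mod8_square (a : int) N : (a = 1 %[mod 8])%Z ->
  exists c : int, [/\ coprimez c 2 & (2 ^+ N %| a - c ^+ 2)%Z].
Proof.
move=> a1; have {}a1 : (8 %| a - 1)%Z by rewrite -eqz_mod_dvd; apply/eqP.
suff [c [c2 dc]] : exists c : int, coprimez c 2 /\ (2 ^+ N.+3 %| a - c ^+ 2)%Z.
  exists c; split=> //; apply: dvdz_trans dc; rewrite -addn3 exprD; exact: dvdz_mulr.
elim: N => [|N [c [c2 /dvdzP[q Eq]]]]; first by exists 1.
have c2' := c2; rewrite (coprimez_primeE (isT : prime 2)) in c2'.
have [q2|q2] := boolP (2 %| q)%Z.
  exists c; split=> //; rewrite Eq exprS; exact: dvdz_mul.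
exists (c + 2 ^+ N.+2); split.
  rewrite (coprimez_primeE (isT : prime 2)) rpredDr // exprS; exact: dvdz_mulr.
rewrite -coprimez_primeE // in q2.
have [u Eu] := odd_intP q2; have [v Ev] := odd_intP c2; pose w := u - v.
have Ew : q = w * 2 + c by rewrite Eu Ev /w; ring.
have -> : a - (c + 2 ^+ N.+2) ^+ 2 = (w - 2 ^+ N) * 2 ^+ N.+4.
  have -> : a = q * 2 ^+ N.+3 + c ^+ 2 by rewrite -Eq subrK.
  by rewrite Ew !exprS; ring.
exact: dvdz_mull.
Qed.

Section EvenTwist.

Variables (R : realType) (T : finZmodType) (psi : T -> QmodZ).
Hypotheses (T2 : (2.-group [set: T])%g) (qpsi : quadratic psi).

Lemma coprimez_2group (d : int) : coprimez d 2 -> coprimez d #|T|.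
Proof. exact: coprimez_cardT. Qed.

Lemma quadratic_2group_torsion : exists N, forall x, psi x *~ (2 ^+ N) = 0.
Proof.
have /p_natP[N] := T2; rewrite cardsT => cardT; exists (N * 2)%N => x.
have -> : (2 ^+ (N * 2) : int) = (#|T| ^ 2)%N.
  by rewrite cardT -expnM -(natrX _ 2) natz.
by rewrite -pmulrn -quadraticMn // mulrn_card quadratic0.
Qed.

Let G a := gauss R (fun x => psi x *~ a).

(** Here [a * b] is 1 modulo 8, hence a square [c ^+ 2] modulo a power of 2 that kills [psi]. Then
    [a * b ^+ 2] and [b * c ^+ 2] act alike on [psi], and odd square factors do not affect the Gauss
    sum. *)
Lemma gauss_twist_mod8 (a b : int) : coprimez b 2 -> (a = b %[mod 8])%Z -> G a = G b.
Proof.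
move=> b2 ab; have [N psiN] := quadratic_2group_torsion.
have [c [c2 dc]] : exists c : int, [/\ coprimez c 2 & (2 ^+ N %| a * b - c ^+ 2)%Z].
  apply: one_mod8_square; have [r r8 br] := odd_int_mod8 b2.
  rewrite -modzMml ab modzMml -modzMml br modzMml -modzMmr br modzMmr.
  by move: r8; rewrite !inE => /or4P[] /eqP ->.
rewrite /G -(@gauss_scale_sqr R T psi qpsi a b) ?coprimez_2group //.
rewrite -(@gauss_scale_sqr R T psi qpsi b c) ?coprimez_2group //.
apply: eq_bigr => x _; congr (expQZ R _); apply/eqP; rewrite -subr_eq0 -mulrzBr.
have -> : a * b ^+ 2 - b * c ^+ 2 = b * (a * b - c ^+ 2) by ring.
by case/dvdzP: dc => q ->; rewrite mulrA mulrC mulrzA psiN mul0rz.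
Qed.

End EvenTwist.

(** * The hexagonal Gauss sum of a tame quadratic function on a 2-group *)

Section EvenPhase.

Variables (R : realType) (T : finZmodType) (psi : T -> QmodZ) (k : nat).
Hypotheses (T2 : (2.-group [set: T])%g) (qpsi : quadratic psi) (tpsi : tame psi).
Hypothesis cardT : #|T| = (2 ^ k * #|radical psi|)%N.

Let G a := gauss R (fun x => psi x *~ a).

Lemma radical_twist (a : int) : coprimez a 2 -> radical (fun x => psi x *~ a) = radical psi.
Proof.
move=> a2; apply/finset.setP => t; rewrite !inE; apply: eq_forallb => s.
rewrite polar_scale; have /coprimezP[[u v] /= E] := coprimez_2group T2 a2.
apply/eqP/eqP => [ca|->]; last by rewrite mul0rz.
rewrite -[LHS]mulr1z -E mulrzDr [u * _]mulrC (mulrzA _ a u) ca mul0rz add0r.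
by rewrite -polarMzl // mulrz_card_dvd ?polar0l // dvdz_mull.
Qed.

Lemma tame_twist (a : int) : coprimez a 2 -> tame (fun x => psi x *~ a).
Proof. by move=> a2 t; rewrite radical_twist // => /tpsi ->; rewrite mul0rz. Qed.

Lemma gauss_twist_norm (a : int) : coprimez a 2 -> `|G a| = `|G 1|.
Proof.
move=> a2; apply/eqP; rewrite -(@eqrXn2 _ 2) ?normr_ge0 //.
have t b : coprimez b 2 -> `|G b| ^+ 2 = #|T|%:R * #|radical psi|%:R.
  move=> b2; rewrite gauss_norm2; [|exact: quadratic_scale|exact: tame_twist].
  by rewrite radical_twist.
by rewrite !t.
Qed.

(** [hexagonal_sum_sign] gives the sign, with an unknown exponent. Twisting by 3 keeps the absolute
    value, so [gauss_cube] gives the hexagonal sum the absolute value [|G 1| ^+ 2]; with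
    [gauss_norm2] this forces the exponent to be [k]. *)
Lemma gauss_hexagonal : gauss R (mxform psi (block_mx 2%:M 1%:M 1%:M 2%:M : 'M_(1 + 1)))
  = (-1) ^+ k * `|G 1| ^+ 2.
Proof.
set K := LHS; have G1 : G 1 = gauss R psi by [].
have [k' Ek'] := @hexagonal_sum_sign R T (polar psi) T2 qpsi.2 (polarC psi).
rewrite -gauss_mxform_hexagonal // -/K in Ek'.
have T0 : #|T|%:R != 0 :> R[i] by rewrite pnatr_eq0 -lt0n; apply/card_gt0P; exists 0.
have G0 : G 1 != 0 by apply: gauss_neq0.
have normK : `|K| = `|G 1| ^+ 2.
  have nG0 : `|G 1| != 0 by rewrite normr_eq0.
  apply: (mulfI nG0); rewrite -{1}(gauss_twist_norm (a := 3)) // -normrM.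
  by rewrite -(gauss_cube R qpsi) ?normrX ?exprS // coprimez_2group.
have k'k : k' = k.
  have : `|#|T|%:R ^+ 2 : R[i]| = `|(- 2) ^+ k' * K| by rewrite Ek'.
  rewrite (normrM (_ ^+ k')) !normrX normrN !normr_nat normK G1.
  rewrite gauss_norm2 // mulrCA expr2 => /(mulfI T0) /eqP.
  rewrite -natrX -natrM cardT eqr_nat eqn_pmul2r ?eqn_exp2l // => [/eqP ->|] //.
  by apply/card_gt0P; exists 0; rewrite inE; apply/forallP => s; rewrite polar0l.
have cT : #|T|%:R = 2 ^+ k * #|radical psi|%:R :> R[i] by rewrite cardT natrM natrX.
rewrite k'k in Ek'; apply: (mulfI (_ : (-2) ^+ k != 0)).
  by rewrite expf_neq0 // oppr_eq0 pnatr_eq0.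
by rewrite -Ek' G1 gauss_norm2 // mulrA -exprMn mulrNN mulr1 mulrCA -cT expr2.
Qed.

End EvenPhase.

(** * Phases of odd twists on a 2-group *)

Lemma ell2_mod8 (a b : int) : (a = b %[mod 8])%Z -> ell 2 a = ell 2 b.
Proof. by rewrite /ell /= => ->. Qed.

Lemma ell2_oddM a b : coprimez a 2 -> coprimez b 2 ->
  ell 2 (a * b) = (ell 2 a + ell 2 b)%N %[mod 2].
Proof.
move=> /odd_int_mod8[r r8 ar] /odd_int_mod8[s s8 bs].
have -> : ell 2 (a * b) = ell 2 (r * s)%N.
  by apply: ell2_mod8; rewrite PoszM -modzMml ar modzMml -modzMmr bs modzMmr.
rewrite (ell2_mod8 ar) (ell2_mod8 bs).
by move: r8 s8; rewrite !inE => /or4P[] /eqP -> /or4P[] /eqP ->.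
Qed.

Lemma ell2_odd_sqr a : coprimez a 2 -> ell 2 (a ^+ 2) = 0%N.
Proof.
move=> /odd_int_mod8[r r8 ar]; rewrite (_ : ell 2 _ = ell 2 (r * r)%N).
  by move: r8; rewrite !inE => /or4P[] /eqP ->.
by apply: ell2_mod8; rewrite expr2 PoszM -modzMml ar modzMml -modzMmr ar modzMmr.
Qed.

Lemma toQmodZ_halfN n : - toQmodZ (n%:R / 2) = toQmodZ (n%:R / 2).
Proof.
apply/eqP; rewrite eq_sym -subr_eq0 opprK -mulr2n -raddfMn -(mulr_natr (_ / _)) divfK //.
by rewrite toQmodZ_eq0 rpred_nat.
Qed.

Lemma mulrz_mod8 (x : QmodZ) (a b : int) : x *+ 8 = 0 -> (a = b %[mod 8])%Z ->
  x *~ a = x *~ b.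
Proof.
move=> x8 /eqP; rewrite eqz_mod_dvd => /dvdzP[q Eq]; apply/eqP.
by rewrite -subr_eq0 -mulrzBr Eq mulrC mulrzA -pmulrn x8 mul0rz.
Qed.

Section EvenFormula.

Variables (R : realType) (T : finZmodType) (psi : T -> QmodZ) (k : nat).
Hypotheses (T2 : (2.-group [set: T])%g) (qpsi : quadratic psi) (tpsi : tame psi).
Hypothesis cardT : #|T| = (2 ^ k * #|radical psi|)%N.

Let G a := gauss R (fun x => psi x *~ a).

Let G0 (a : int) : coprimez a 2 -> G a != 0.
Proof.
move=> a2; apply: gauss_neq0; first exact: quadratic_scale.
exact: tame_twist a2.
Qed.

Let G_cube (a : int) : coprimez a 2 -> G a ^+ 3 = G (a * 3) * ((-1) ^+ k * `|G 1| ^+ 2).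
Proof.
move=> a2; have qa := quadratic_scale qpsi a; have ta := tame_twist T2 qpsi tpsi a2.
have cardTa : #|T| = (2 ^ k * #|radical (fun x => psi x *~ a)|)%N.
  by rewrite cardT radical_twist.
have fa b : gauss R (fun x => psi x *~ a *~ b) = G (a * b).
  by apply: eq_bigr => x _; rewrite mulrzA.
have := gauss_cube R qa (coprimez_2group T2 (isT : coprimez 3 2)).
rewrite (gauss_hexagonal R T2 qa ta cardTa) !fa mulr1 => ->.
by rewrite (gauss_twist_norm R T2 qpsi tpsi a2).
Qed.

(** Cubing the cube relation gives [G 1 ^+ 9 = G 9 * |G 1| ^+ 8], the signs cancelling since they
    occur [4 * k] times; and [G 9 = G 1] because 9 is 1 modulo 8. *)
Lemma has_phase_gauss_even : exists x, has_phase (gauss R psi) x /\ x *+ 8 = 0.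
Proof.
have co1 : coprimez 1 2 by []. have co3 : coprimez 3 2 by [].
have E1 : G 1 = gauss R psi by [].
have E9 : G (3 * 3) = G 1 by apply: gauss_twist_mod8.
apply: has_phase8; first exact: (G0 co1).
rewrite -E1; apply: (mulfI (G0 co1)).
transitivity ((G 1 ^+ 3) ^+ 3); first by rewrite -exprS -exprM.
rewrite (G_cube co1) mul1r exprMn (G_cube co3) E9.
set N := `|_|; rewrite !exprMn -!exprM.
have s4 : (-1) ^+ k * (-1) ^+ (k * 3) = 1 :> R[i].
  by rewrite -exprD -mulnS -signr_odd oddM andbF.
by rewrite -(mulrA (G 1)) mulrACA s4 mul1r -!exprD.
Qed.

(** Only [a] modulo 8 matters. The residue 3 comes from the cube relation, and 5 and 7 are obtained
    from 3 and 1 by complex conjugation. *)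
Lemma has_phase_twist_even x (a : int) : has_phase (gauss R psi) x -> x *+ 8 = 0 ->
  coprimez a 2 -> has_phase (G a) (x *~ a + toQmodZ ((ell 2 a * k)%:R / 2)).
Proof.
move=> hx x8 a2; have [r r8 ar] := odd_int_mod8 a2.
have r2 : coprimez r 2 by move: r8; rewrite !inE => /or4P[] /eqP ->.
rewrite (mulrz_mod8 x8 ar) (ell2_mod8 ar) /G (gauss_twist_mod8 R T2 qpsi r2 ar) -/(G r).
have co1 : coprimez 1 2 by [].
have neg (b : int) y : has_phase (G b) y -> has_phase (G (- b)) (- y).
  move=> /has_phase_conj; rewrite -gauss_conj; congr has_phase.
  by apply: eq_bigr => t _; rewrite mulrNz.
have h3 : has_phase (G 3) (x *~ 3 + toQmodZ (k%:R / 2)).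
  rewrite -toQmodZ_halfN; apply: (has_phase_divr (w := (-1) ^+ k * `|G 1| ^+ 2)).
    by rewrite -[G 3]/(G (1 * 3)) -G_cube // -pmulrn; apply: has_phaseX.
  rewrite -[toQmodZ _]addr0; apply: has_phaseM; first exact: has_phase_sign.
  by apply: has_phase_pos; rewrite exprn_gt0 // normr_gt0 G0.
have mod8 (b c : int) : coprimez b 2 -> (c = b %[mod 8])%Z -> G c = G b.
  by move=> b2 cb; apply: gauss_twist_mod8.
move: r8; rewrite !inE => /or4P[] /eqP ->.
- by rewrite mul0n mul0r (raddf0 toQmodZ) addr0.
- by rewrite mul1n.
- rewrite mul1n (mod8 (- 3) 5) //; have := neg _ _ h3; rewrite (opprD (x *~ 3)) toQmodZ_halfN.
  by rewrite -mulrNz (@mulrz_mod8 x (- 3) 5).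
rewrite (mod8 (- 1) 7) // mul0n mul0r (raddf0 toQmodZ) addr0.
rewrite (@mulrz_mod8 x 7 (- 1)) // mulrNz; exact: (neg 1 x hx).
Qed.

End EvenFormula.

(** * Gauss sums of reduced matrices *)

(** An integer version of the weight in [sigma2_reduced]: modulo 8 an odd entry is its own weight.
    Pseudo-hyperbolics count for 0 whatever their diagonal. *)
Definition summand_trace (b : summand) : int := if b is RankOne a then a else 0.

Definition reduced_trace (s : seq summand) : int := \sum_(b <- s) summand_trace b.

Lemma tr_summand_mx b : (summand_mx b)^T = summand_mx b.
Proof.
case: b => [a|m1 m2]; first exact: tr_scalar_mx.
have := @tr_block_mx int 1 1 1 1 (2 * m1)%:M 1%:M 1%:M (2 * m2)%:M.
by rewrite !tr_scalar_mx.
Qed.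

Lemma tr_reduced_mx s : (reduced_mx s)^T = reduced_mx s.
Proof.
elim: s => [|b s IH] /=; first by rewrite trmx0.
by rewrite tr_block_mx !trmx0 tr_summand_mx IH.
Qed.

Lemma coprimez_odd2 (m : int) : coprimez (2 * m + 1) 2.
Proof.
by rewrite (coprimez_primeE (isT : prime 2)) rpredDl // dvdz_mulr.
Qed.

Section ReducedFormula.

Variables (R : realType) (T : finZmodType) (psi : T -> QmodZ) (k : nat).
Hypotheses (T2 : (2.-group [set: T])%g) (qpsi : quadratic psi) (tpsi : tame psi).
Hypothesis cardT : #|T| = (2 ^ k * #|radical psi|)%N.
Variable x : QmodZ.
Hypotheses (hx : has_phase (gauss R psi) x) (x8 : x *+ 8 = 0).

Let half_ellD a b : coprimez a 2 -> coprimez b 2 ->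
  toQmodZ ((ell 2 (a * b) * k)%:R / 2) =
  toQmodZ ((ell 2 a * k)%:R / 2) + toQmodZ ((ell 2 b * k)%:R / 2).
Proof.
move=> a2 b2; rewrite -toQmodZ_halfD -mulnDl; apply: (toQmodZ_half_mod R).
by rewrite -modnMml ell2_oddM // modnMml.
Qed.

(** By [gauss_pseudo_hyp] the coefficient of [x] is [a + b + a * b * d - 1], a multiple of 8, where
    [- 1] accounts for the extra rank one summand. The symbols of [a] and [b] occur twice and
    cancel; that of [d] remains. *)
Lemma has_phase_pseudo_hyp (m1 m2 : int) :
  has_phase (gauss R (mxform psi (summand_mx (PseudoHyp m1 m2))))
    (toQmodZ ((ell 2 (4 * m1 * m2 - 1) * k)%:R / 2)).
Proof.
set a := 2 * m1 + 1; set b := 2 * m2 + 1; set d := 4 * m1 * m2 - 1.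
have a2 : coprimez a 2 by apply: coprimez_odd2.
have b2 : coprimez b 2 by apply: coprimez_odd2.
have d2 : coprimez d 2.
  by rewrite (_ : d = 2 * (2 * m1 * m2 - 1) + 1) ?coprimez_odd2 // /d; ring.
have ab2 : coprimez (a * b) 2 by rewrite coprimezMl a2.
have abd2 : coprimez (a * b * d) 2 by rewrite coprimezMl ab2.
have E := gauss_pseudo_hyp R (m1 := m1) (m2 := m2) qpsi (coprimez_2group T2 a2)
  (coprimez_2group T2 b2); rewrite -/a -/b -/d in E.
have tw c := has_phase_twist_even T2 qpsi tpsi cardT hx x8 (a := c).
have := has_phaseM (has_phaseM (tw _ a2) (tw _ b2)) (tw _ abd2).
rewrite -E => /has_phase_divr/(_ hx); congr (has_phase _ _).
rewrite (half_ellD ab2 d2) (half_ellD a2 b2).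
set la := toQmodZ _; set lb := toQmodZ _; set ld := toQmodZ _.
have l2 n : toQmodZ (n%:R / 2) + toQmodZ (n%:R / 2) = 0.
  by rewrite -{1}toQmodZ_halfN addNr.
have -> : x *~ a + la + (x *~ b + lb) + (x *~ (a * b * d) + (la + lb + ld)) - x =
  (x *~ a + x *~ b + x *~ (a * b * d) - x) + ((la + la) + (lb + lb) + ld).
  by rewrite (AC ((2*2)*(1*(2*1))*1)%AC ((1*3*5*9)*((2*6)*(4*7)*8))%AC).
rewrite !l2 !add0r -[X in - X]mulr1z -!mulrzDr -mulrzBr.
rewrite (mulrz_mod8 (b := 0)) ?add0r //; apply/eqP; rewrite eqz_mod_dvd subr0.
have -> : a + b + a * b * d - 1 = 8 * (2 * (m1 * m2) ^+ 2 + (m1 * m2) * (m1 + m2)).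
  by rewrite /a /b /d; ring.
exact: dvdz_mulr.
Qed.

Lemma has_phase_reduced s : coprimez (\det (reduced_mx s)) 2 ->
  has_phase (gauss R (mxform psi (reduced_mx s)))
    (x *~ reduced_trace s + toQmodZ ((ell 2 (\det (reduced_mx s)) * k)%:R / 2)).
Proof.
rewrite /reduced_trace; elim: s => [|b s IH] /=.
  move=> _; rewrite gauss_mxform0 // det_mx00 big_nil mulr0z add0r.
  by rewrite mul0n mul0r (raddf0 toQmodZ); apply: has_phase1.
rewrite gauss_mxform_block ?tr_summand_mx ?tr_reduced_mx // det_lblock coprimezMl.
move=> /andP[b2 /[dup] s2 /IH hs]; rewrite (half_ellD b2 s2) big_cons mulrzDr addrACA.
apply: has_phaseM hs; case: b b2 => [a|m1 m2] /=.
  by rewrite det_scalar1 gauss_mxform_scalar; apply: has_phase_twist_even.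
have E : block_mx (2 * m1)%:M 1%:M 1%:M (2 * m2)%:M = even_block m1 1 m2 by [].
rewrite mulr0z add0r E det_even_block expr1n => _; apply: has_phase_pseudo_hyp.
Qed.

End ReducedFormula.

(** * Existence of reduced matrices modulo powers of 2 *)

Definition eqmx_mod (W : int) m n (A C : 'M[int]_(m, n)) :=
  forall i j, (A i j = C i j %[mod W])%Z.

Lemma eqmx_mod_block W m1 m2 n1 n2 (A1 C1 : 'M_(m1, n1)) (A2 C2 : 'M_(m1, n2))
    (A3 C3 : 'M_(m2, n1)) (A4 C4 : 'M_(m2, n2)) :
  eqmx_mod W A1 C1 -> eqmx_mod W A2 C2 -> eqmx_mod W A3 C3 -> eqmx_mod W A4 C4 ->
  eqmx_mod W (block_mx A1 A2 A3 A4) (block_mx C1 C2 C3 C4).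
Proof.
move=> E1 E2 E3 E4 i j; case: (split_ordP i) => i' ->; case: (split_ordP j) => j' ->;
rewrite ?(block_mxEul, block_mxEur, block_mxEdl, block_mxEdr);
first [exact: E1 | exact: E2 | exact: E3 | exact: E4].
Qed.

Lemma eqmx_mod_scalar W n (a b : int) : (a = b %[mod W])%Z ->
  eqmx_mod W (a%:M : 'M_n) b%:M.
Proof. by move=> ab i j; rewrite !mxE; case: (i == j); rewrite ?mulr1n ?mulr0n. Qed.

Lemma odd_inverse_mod2 (c : int) N : coprimez c 2 -> exists d : int,
  coprimez d 2 /\ (c * d = 1 %[mod 2 ^+ N])%Z.
Proof.
(* The extra factor 2 in the modulus makes the inverse [u] odd even when [N = 0]. *)
move=> c2; have /coprimezP[[u v] /= E] : coprimez c (2 ^+ N.+1).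
  by rewrite coprimez_sym coprimezXl // coprimez_sym.
exists u; split; last first.
  have Ecu : c * u = 1 - v * 2 * 2 ^+ N by rewrite mulrC (canRL (addrK _) E) exprS mulrA.
  apply/eqP; rewrite eqz_mod_dvd Ecu addrAC subrr add0r rpredN; exact: dvdz_mull.
rewrite (coprimez_primeE (isT : prime 2)); apply/negP => u2.
have : (2 %| u * c + v * 2 ^+ N.+1)%Z.
  apply: rpredD; first exact: dvdz_mulr.
  by rewrite exprS; apply/dvdz_mull/dvdz_mulr.
by rewrite E.
Qed.

(** The integral decomposition leaves even blocks with an odd off-diagonal entry [c]. Scaling one
    basis vector by an inverse [d] of [c] modulo [2 ^+ N] makes that entry 1 and turns [m2] into
    [m2 * d ^+ 2]. *)
Lemma exists_reduced_mod2 N n (A : 'M[int]_n) : A^T = A -> coprimez (\det A) 2 ->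
  exists (s : seq summand) (eq_n : reduced_dim s = n) (M : 'M[int]_n),
    coprimez (\det M) 2 /\
    eqmx_mod (2 ^+ N) (castmx (eq_n, eq_n) (reduced_mx s)) (M^T *m A *m M).
Proof.
move: n A; apply: (symmetric_int_ind (isT : prime 2)).
- move=> A; exists [::], erefl, 1%:M; rewrite det_mx00; split=> //; by case.
- move=> n a A _ a2 _ [s [eq_n]]; case: _ / eq_n A => A [M [M2 EM]].
  exists (RankOne a :: s), erefl, (block_mx 1%:M 0 0 M); split.
    by rewrite det_lblock det1 mul1r.
  rewrite castmx_id /= in EM *; rewrite tr_block_mx !trmx0 trmx1 !mulmx_block.
  rewrite !(mul0mx, mulmx0, addr0, add0r) mul1mx mulmx1.
  by apply: eqmx_mod_block.
- move=> _ n m1 c m2 A _ c2 _ [s [eq_n]]; case: _ / eq_n A => A [M [M2 EM]].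
  have [d [d2 cd]] := odd_inverse_mod2 N c2.
  exists (PseudoHyp m1 (m2 * d ^+ 2) :: s), erefl.
  exists (block_mx (block_mx 1%:M 0 0 d%:M : 'M_(1 + 1)) 0 0 M); split.
    by rewrite !det_lblock det1 mul1r det_scalar1 coprimezMl d2.
  rewrite castmx_id /= in EM *; rewrite tr_block_mx !trmx0 !mulmx_block.
  rewrite !(mul0mx, mulmx0, addr0, add0r); apply: eqmx_mod_block => //.
  rewrite tr_block_mx !trmx0 trmx1 tr_scalar_mx /even_block !mulmx_block.
  rewrite !(mul0mx, mulmx0, addr0, add0r, mul1mx, mulmx1) -!scalar_mxM.
  apply: eqmx_mod_block => //; apply: eqmx_mod_scalar; rewrite ?cd //.
    by rewrite mulrC cd.
  by congr (_ %% _)%Z; ring.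
move=> n A M symA M2 [s [eq_n [M' [M'2 EM]]]]; exists s, eq_n, (M *m M'); split.
  by rewrite det_mulmx coprimezMl M2.
by rewrite trmx_mul !mulmxA in EM *.
Qed.

(** * Computing [sigma_2] of a reduced matrix in Z/8 *)

Lemma Z8_intr_eq0 (a : int) : (a%:~R == 0 :> 'Z_8) = (8 %| a)%Z.
Proof.
rewrite {1}[a]intEsign rmorphM /= rmorph_sign.
have nat_case n : ((n%:R : 'Z_8) == 0) = (8 %| n)%N.
  by rewrite -(inj_eq val_inj) /= val_Zp_nat.
rewrite -pmulrn dvdzE /= -nat_case.
by case: (a < 0)%R; rewrite ?expr0 ?expr1 ?mul1r // mulN1r oppr_eq0.
Qed.

Lemma Z8_intr_eq (a b : int) : (a%:~R == b%:~R :> 'Z_8) = (a == b %[mod 8])%Z.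
Proof. by rewrite -subr_eq0 -rmorphB Z8_intr_eq0 eqz_mod_dvd. Qed.

Lemma det_eqmx_mod8 n (A C : 'M[int]_n) : eqmx_mod 8 A C -> (\det A = \det C %[mod 8])%Z.
Proof.
move=> eqA; apply/eqP; rewrite -Z8_intr_eq -!det_map_mx.
by apply/eqP; congr (\det _); apply/matrixP => i j; rewrite !mxE; apply/eqP; rewrite Z8_intr_eq eqA.
Qed.

Lemma mulrn_Z8 (x : QmodZ) (a : int) : x *+ 8 = 0 -> x *+ (a%:~R : 'Z_8) = x *~ a.
Proof.
move=> x8; rewrite pmulrn; apply: mulrz_mod8 => //; apply/eqP.
by rewrite -Z8_intr_eq -pmulrn natr_Zp.
Qed.

(** An odd determinant makes every rank one entry odd, so each is counted by exactly one of the four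
    [N_i], with a weight congruent to itself modulo 8. *)
Lemma sigma2_reducedE s : coprimez (\det (reduced_mx s)) 2 ->
  sigma2_reduced s = (reduced_trace s)%:~R.
Proof.
rewrite /reduced_trace; elim: s => [|b s IH] /=.
  by move=> _; rewrite big_nil /sigma2_reduced /= !mulr0 !subr0 addr0.
rewrite det_lblock coprimezMl => /andP[b2 /IH Es]; rewrite big_cons rmorphD /= -Es.
case: b b2 => [a|m1 m2] /= b2; last by rewrite add0r.
rewrite det_scalar1 in b2; have [r r8 ar] := odd_int_mod8 b2.
have -> : a%:~R = r%:~R :> 'Z_8 by apply/eqP; rewrite Z8_intr_eq ar.
rewrite /sigma2_reduced /count_rank1 /= ar.
set n1 := count _ s; set n2 := count _ s; set n3 := count _ s; set n4 := count _ s.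
move: r8; rewrite !inE => /or4P[] /eqP -> /=; rewrite ?natrD ?add0n;
  move: (n1%:R) (n2%:R) (n3%:R) (n4%:R) => c1 c2 c3 c4.
1,2: ring.
  by have -> : 5%:~R = - 3 :> 'Z_8; [apply: val_inj | ring].
by have -> : 7%:~R = - 1 :> 'Z_8; [apply: val_inj | ring].
Qed.

(** * The form [x^2 / 4] on Z/2, used to detect integers modulo 8 *)

Section TestForm.

Variable R : realType.

Definition quarter_form (x : 'F_2) : QmodZ := toQmodZ ((x : nat)%:R ^+ 2 / 4).

(** Integers congruent modulo 2 have squares congruent modulo 4, so any representative may be
    used. *)
Lemma quarter_form_int (z : int) : quarter_form z%:~R = toQmodZ (z%:~R ^+ 2 / 4).
Proof.
set x : 'F_2 := z%:~R; have /dvdzP[w Ew] : (2 %| z - (x : nat)%:Z)%Z.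
  by rewrite -(Fp_intr_eq0 (isT : prime 2)) rmorphB /= -pmulrn natr_Zp subrr.
have -> : z = w * 2 + (x : nat)%:Z by rewrite -Ew subrK.
apply/eqP; rewrite eq_sym -subr_eq0 -raddfB toQmodZ_eq0.
set n : nat := x; have -> : (w * 2 + n%:Z)%:~R ^+ 2 / 4 - n%:R ^+ 2 / 4 =
  (w ^+ 2 + w * n%:Z)%:~R :> rat.
  by rewrite !rmorphD !rmorphM /= -!pmulrn; field.
exact: intr_int.
Qed.

Lemma F2_intr (x : 'F_2) : x = (x : nat)%:Z%:~R.
Proof. by rewrite -pmulrn natr_Zp. Qed.

Lemma quarter_form_polar (z w : int) :
  polar quarter_form z%:~R w%:~R = toQmodZ ((z * w)%:~R / 2).
Proof.
rewrite /polar -rmorphD !quarter_form_int -!raddfB; congr toQmodZ.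
by rewrite rmorphD rmorphM /=; field.
Qed.

Lemma quadratic_quarter_form : quadratic quarter_form.
Proof.
split=> [a x|].
  rewrite [x]F2_intr -mulrzr -rmorphM !quarter_form_int -raddfMz; congr toQmodZ.
  by rewrite -[RHS]mulrzr !rmorphM /=; ring.
split=> [v x y|u x y].
  rewrite [x]F2_intr [y]F2_intr [v]F2_intr -rmorphB !quarter_form_polar -raddfB.
  by congr toQmodZ; rewrite mulrBl rmorphB mulrBl.
rewrite [x]F2_intr [y]F2_intr [u]F2_intr -rmorphB !quarter_form_polar -raddfB.
by congr toQmodZ; rewrite mulrBr rmorphB mulrBl.
Qed.

Lemma radical_quarter_form : radical quarter_form = [set 0]%SET.
Proof.
apply/finset.setP => t; rewrite !inE; apply/forallP/eqP => [/(_ 1)|-> s].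
  rewrite [t]F2_intr -[1]/(1%:~R) quarter_form_polar mulr1.
  rewrite (toQmodZ_muln_eq0 t (isT : (0 < 2)%N)) => /dvdnP[q ->].
  by apply/eqP; rewrite (Fp_intr_eq0 (isT : prime 2)) dvdzE /= dvdn_mull.
by rewrite polar0l //; apply: quadratic_quarter_form.
Qed.

Lemma tame_quarter_form : tame quarter_form.
Proof.
by move=> t; rewrite radical_quarter_form inE => /eqP ->; rewrite quadratic0 //;
  apply: quadratic_quarter_form.
Qed.

Lemma F2_2group : (2.-group [set: 'F_2])%g.
Proof. by rewrite /pgroup cardsT card_Fp. Qed.

Lemma card_quarter_form : #|'F_2| = (2 ^ 1 * #|radical quarter_form|)%N.
Proof. by rewrite radical_quarter_form finset.cards1 card_Fp. Qed.

Lemma quarter_form_torsion x : quarter_form x *~ 8 = 0.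
Proof.
apply/eqP; rewrite /quarter_form -raddfMz toQmodZ_eq0 -mulrzr -mulrA.
by rewrite rpredM // rpredX // rpred_nat.
Qed.

(* The Gauss sum is [1 + i], of phase [1 / 8]. *)
Lemma quarter_form_order (x : QmodZ) (m : int) :
  has_phase (gauss R quarter_form) x -> x *+ 8 = 0 -> x *~ m = 0 -> (8 %| m)%Z.
Proof.
move=> hx x8 xm.
(* If 4 killed the phase, [(1 + i)^4 = -4] would be a nonnegative real. *)
have x4 : x *+ 4 != 0.
  apply/eqP => x4; have := (has_phaseX 4 hx).2; rewrite x4 expQZ0 mulr1.
  have -> : gauss R quarter_form = 1 + expQZ R (toQmodZ (1 / 4)).
    rewrite /gauss big_ord_recl big_ord1 /quarter_form /= -expQZ0 expr0n mul0r expr1n.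
    by rewrite (raddf0 toQmodZ).
  set u := expQZ R _; have u2 : u ^+ 2 = -1.
    by rewrite -expQZMn -expQZ_half -raddfMn; congr (expQZ R (toQmodZ _)).
  have -> : (1 + u) ^+ 4 = - 4.
    have -> : (1 + u) ^+ 4 = (u ^+ 2 + 1 + 2 * u) ^+ 2 by ring.
    by rewrite u2 addNr add0r exprMn u2; ring.
  move=> E; have : 0 <= - 4 :> R[i] by rewrite E normr_ge0.
  by rewrite oppr_ge0 (lern0 _ 4).
have g0 : x *~ (gcdz m 8) = 0.
  have [u [v <-]] := Bezoutz m 8.
  by rewrite mulrzDr [u * m]mulrC (mulrzA _ m u) xm mul0rz add0r [v * _]mulrC
    (mulrzA _ 8 v) -pmulrn x8 mul0rz.
have : (gcdz m 8 %| 8)%Z by apply: dvdz_gcdr.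
move: (dvdz_gcdl m 8) g0; rewrite /gcdz; set g := gcdn _ _.
case: (boolP (8 %| g)%N) => [g8 gm _ _|g8 _ xg].
  by apply: dvdz_trans gm; rewrite dvdzE.
rewrite dvdzE /= => gd8; case/negP: x4; apply/eqP.
have /dvdnP[q ->] : (g %| 4)%N.
  by move: gd8 g8; rewrite (dvdn_divisors _ (isT : (0 < 8)%N)) !inE => /or4P[] /eqP ->.
by rewrite mulnC mulrnA (_ : x *+ g = 0) ?mul0rn // pmulrn.
Qed.

End TestForm.

(** * Independence of [sigma_2] from the reduced matrix, and the formula for [p = 2] *)

Lemma reduced_det_mod8 n (A M : 'M[int]_n) s (eq_n : reduced_dim s = n) :
  eqmx_mod 8 (castmx (eq_n, eq_n) (reduced_mx s)) (M^T *m A *m M) ->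
  (\det (reduced_mx s) = \det M ^+ 2 * \det A %[mod 8])%Z.
Proof.
case: _ / eq_n A M => A M; rewrite castmx_id => /det_eqmx_mod8.
by rewrite det_congr.
Qed.

Lemma reduced_det_odd n (A M : 'M[int]_n) s (eq_n : reduced_dim s = n) :
  coprimez (\det A) 2 -> coprimez (\det M) 2 ->
  eqmx_mod 8 (castmx (eq_n, eq_n) (reduced_mx s)) (M^T *m A *m M) ->
  coprimez (\det (reduced_mx s)) 2.
Proof.
move=> A2 M2 /reduced_det_mod8 /eqP; rewrite eqz_mod_dvd => ab.
have : coprimez (\det M ^+ 2 * \det A) 2 by rewrite coprimezMl A2 coprimezXl.
rewrite !(coprimez_primeE (isT : prime 2)); apply: contra => a2.
by rewrite -(subKr (\det (reduced_mx s)) (_ * _)) rpredB //; apply: dvdz_trans ab.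
Qed.

Lemma eqmx_mod2_mod8 N m n (A C : 'M[int]_(m, n)) : (3 <= N)%N ->
  eqmx_mod (2 ^+ N) A C -> eqmx_mod 8 A C.
Proof.
move=> N3 EM i j; apply/eqP; rewrite eqz_mod_dvd; apply: dvdz_trans (_ : (2 ^+ N %| _)%Z).
  by rewrite -(subnKC N3) exprD; apply: dvdz_mulr.
by rewrite -eqz_mod_dvd EM.
Qed.

Section EvenTheorem.

Variable R : realType.

Lemma has_phase_congr_reduced (T : finZmodType) (psi : T -> QmodZ) k N x n
    (A M : 'M[int]_n) s (eq_n : reduced_dim s = n) :
  (2.-group [set: T])%g -> quadratic psi -> tame psi ->
  #|T| = (2 ^ k * #|radical psi|)%N ->
  (forall t, psi t *~ (2 ^+ N) = 0) -> (3 <= N)%N ->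
  has_phase (gauss R psi) x -> x *+ 8 = 0 ->
  A^T = A -> coprimez (\det A) 2 -> coprimez (\det M) 2 ->
  eqmx_mod (2 ^+ N) (castmx (eq_n, eq_n) (reduced_mx s)) (M^T *m A *m M) ->
  has_phase (gauss R (mxform psi A))
    (x *~ reduced_trace s + toQmodZ ((ell 2 (\det A) * k)%:R / 2)).
Proof.
move=> T2 qpsi tpsi cardT psiN N3 hx x8 symA A2 M2.
move=> EM; have EM8 := eqmx_mod2_mod8 N3 EM.
have s2 := reduced_det_odd A2 M2 EM8; have detE := reduced_det_mod8 EM8.
rewrite -(gauss_mxform_act R qpsi symA (coprimez_2group T2 M2)).
rewrite -(gauss_mxform_mod R psiN EM).
(* Modulo 8 the two determinants differ by an odd square, to which [ell 2] is insensitive. *)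
have -> : toQmodZ ((ell 2 (\det A) * k)%:R / 2) =
    toQmodZ ((ell 2 (\det (reduced_mx s)) * k)%:R / 2).
  apply: (toQmodZ_half_mod R); rewrite (ell2_mod8 detE) -[RHS]modnMml.
  by rewrite ell2_oddM ?coprimezXl // ell2_odd_sqr // modnMml.
case: _ / eq_n A M symA A2 M2 EM EM8 detE => *; rewrite castmx_id.
exact: has_phase_reduced.
Qed.

(** Both reductions compute the phase of [A] on the test form. The terms in [ell] depend only on
    [\det A] and cancel, so the difference of the traces kills a phase of order 8. *)
Lemma reduced_trace_unique n (A M M' : 'M[int]_n) s s' (eq_n : reduced_dim s = n)
    (eq_n' : reduced_dim s' = n) :
  A^T = A -> coprimez (\det A) 2 -> coprimez (\det M) 2 -> coprimez (\det M') 2 ->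
  eqmx_mod 8 (castmx (eq_n, eq_n) (reduced_mx s)) (M^T *m A *m M) ->
  eqmx_mod 8 (castmx (eq_n', eq_n') (reduced_mx s')) (M'^T *m A *m M') ->
  (reduced_trace s = reduced_trace s' %[mod 8])%Z.
Proof.
move=> symA A2 M2 M2' EM EM'.
have q := quadratic_quarter_form; have t := tame_quarter_form.
have [x [hx x8]] := has_phase_gauss_even R F2_2group q t card_quarter_form.
have F s1 M1 (eq1 : reduced_dim s1 = n) :=
  @has_phase_congr_reduced _ _ _ 3 x n A M1 s1 eq1 F2_2group q t card_quarter_form
    quarter_form_torsion isT hx x8 symA A2.
have := has_phase_inj (F _ _ _ M2 EM) (F _ _ _ M2' EM').
move/addIr => /eqP; rewrite -subr_eq0 -mulrzBr => /eqP.
by move/(quarter_form_order hx x8); rewrite -eqz_mod_dvd => /eqP.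
Qed.

Lemma has_phase_mxform_even (T : finZmodType) (psi : T -> QmodZ) k x n (A : 'M[int]_n) :
  (2.-group [set: T])%g -> quadratic psi -> tame psi ->
  #|T| = (2 ^ k * #|radical psi|)%N ->
  has_phase (gauss R psi) x -> x *+ 8 = 0 ->
  A^T = A -> coprimez (\det A) 2 ->
  has_phase (gauss R (mxform psi A))
    (x *+ sigma 2 A + toQmodZ ((ell 2 (\det A) * k)%:R / 2)).
Proof.
move=> T2 qpsi tpsi cardT hx x8 symA A2.
have [N psiN] := quadratic_2group_torsion T2 qpsi.
(* The exponent [3 + N] makes congruence of matrices imply both equality of the forms on [T] and
   congruence modulo 8. *)
have psiN3 t : psi t *~ (2 ^+ (3 + N)) = 0.
  by rewrite exprD mulrC mulrzA psiN mul0rz.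
have [s [eq_n [M [M2 EM]]]] := exists_reduced_mod2 (3 + N) symA A2.
have EM8 : eqmx_mod 8 (castmx (eq_n, eq_n) (reduced_mx s)) (M^T *m A *m M).
  exact: eqmx_mod2_mod8 EM.
have := has_phase_congr_reduced T2 qpsi tpsi cardT psiN3 isT hx x8 symA A2 M2 EM.
congr (has_phase _ (_ + _)); rewrite /sigma /=.
pose S := [set v : 'Z_8 | exists (t : seq summand) (eq_t : reduced_dim t = n),
  similar8 A (castmx (eq_t, eq_t) (reduced_mx t)) /\ v = sigma2_reduced t]%classic.
have odd2 (a : int) : coprimez a 2 = ~~ (2 %| a)%Z := coprimez_primeE (isT : prime 2) a.
(* The set is inhabited by the value of [s], so the default 0 is not what [xget] returns. The value
   may come from another reduced matrix [s'], which is compared with [s] by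
   [reduced_trace_unique]. *)
have : S (xget 0 S).
  apply: xgetPex; exists (sigma2_reduced s), s, eq_n; split=> //.
  by exists M; split; [rewrite -odd2 | exact: EM8].
rewrite -/S => -[s' [eq_n' [[M' [M2' EM']] ->]]]; rewrite -odd2 in M2'.
have trE := reduced_trace_unique symA A2 M2 M2' EM8 EM'.
rewrite sigma2_reducedE ?mulrn_Z8 //; first exact: mulrz_mod8 trE.
exact: reduced_det_odd A2 M2' EM'.
Qed.

End EvenTheorem.

(** * The order of the radical quotient, and the tensor product as a matrix form *)

Lemma card_quotient_radical (T : finZmodType) (psi : T -> QmodZ) : quadratic psi ->
  #|T| = (#|([set: T] / radical psi)%g| * #|radical psi|)%N.
Proof.
move=> qpsi.
have grp : group_set (radical psi).
  apply/group_setP; split=> [|x y]; rewrite !inE.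
    by apply/forallP => s; rewrite polar0l.
  move=> /forallP px /forallP py; apply/forallP => s.
  by rewrite [(x * y)%g]/(x + y) polarDl // (eqP (px s)) (eqP (py s)) addr0.
pose H := Group grp; have := @card_quotient T H [set: T]%G.
rewrite -[gval H]/(radical psi) => ->; first last.
  by apply: sub_abelian_norm; [exact: FinRing.zmod_abelian | exact: finset.subsetT].
by rewrite mulnC (Lagrange (finset.subsetT H)) cardsT.
Qed.

Lemma tensor_mxform (V : zmodType) n (e : 'I_n -> V) (B : V -> V -> int)
    (T : finZmodType) (psi : T -> QmodZ) :
  tensor e B psi = mxform psi (gram e B).
Proof.
apply/funext => t; rewrite /tensor /mxform; congr (_ + _); apply: eq_bigr => i _.
  by rewrite mxE.
by apply: eq_bigr => j _; rewrite mxE.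
Qed.

Theorem theorem2p8 (R : realType) (p : nat) (T : finZmodType) (psi : T -> QmodZ)
    (k : nat) (V : zmodType) (n : nat) (e : 'I_n -> V) (B : V -> V -> int) :
  prime p ->
  (p.-group [set: T])%g ->
  quadratic psi ->
  tame psi ->
  #|([set: T] / radical psi)%g| = (p ^ k)%N ->
  is_Zbasis e ->
  biadditive B ->
  (forall v w, B v w = B w v) ->
  coprimez (\det (gram e B)) p ->
  phase R (tensor e B psi) =
    phase R psi *+ sigma p (gram e B)
    + toQmodZ ((ell p (\det (gram e B)) * k)%:R / 2).
Proof.
move=> pr_p pT qpsi tpsi cardq _ _ symB cop; rewrite tensor_mxform.
have cardT := card_quotient_radical qpsi; rewrite cardq in cardT.
have symA : (gram e B)^T = gram e B by apply/matrixP => i j; rewrite !mxE symB.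
have [p2|p2] := eqVneq p 2%N.
  rewrite p2 in pT cardT cop *.
  have [x [hx x8]] := has_phase_gauss_even R pT qpsi tpsi cardT.
  by rewrite (phase_eq hx); apply: phase_eq; apply: has_phase_mxform_even.
have [x [hx x8]] := has_phase_gauss_odd R pr_p p2 pT qpsi cardT.
rewrite (phase_eq hx); apply: phase_eq; rewrite /sigma (negPf p2).
(* The rank acts through its residue in [{0, ..., 7}], which is harmless because [x *+ 8 = 0]. *)
have -> : x *+ (n%:R : 'Z_8) = x *+ n by rewrite -[n%:R]/(n%:Z%:~R) mulrn_Z8 // pmulrn.
exact: has_phase_mxform_odd.
Qed.
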